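(* Let $r>0$ and let $R(z)$ be a rational function of degree $n$ whose poles do not belong to the circle $\gamma_r=\{z:|z|=r\}$. Set $$\mathcal R(z):=R(z)\cdot\overline{R(r^2/\overline z)}.$$ Denote by $z_k$, $k=1,\dots,\nu$, all pairwise distinct poles of the rational function $\mathcal R$ that lie in the disc $|z|<r$ and by $n_k$ their multiplicities. Set $$B(z)=\prod_{k=1}^{\nu}\left(r\,\frac{z-z_k}{r^2-z\overline{z_k}}\right)^{n_k},\qquad \mu(z)=\sum_{k=1}^{\nu}\frac{n_k(r^2-|z_k|^2)}{|z-z_k|^2},\qquad \sum_{k=1}^{\nu}n_k=n.$$ For $m\in\mathbb N$ and $\varphi\in\mathbb R$ let the notches $\zeta_k(m,\varphi)$, $k=1,\dots,mn+1$, be the roots of the equation $\zeta B^m(\zeta)=re^{i\varphi}$. Then $$\int_{\gamma_r}R(\zeta)\,|d\zeta|=2\pi r\sum_{k=1}^{n+1}\frac{R(\zeta_k)}{\mu(\zeta_k)+1},\qquad \zeta_k=\zeta_k(1,\varphi);$$ $$\|R\|_{L^{2m}(\gamma_r)}^{2m}:=\int_{\gamma_r}|R(\zeta)|^{2m}\,|d\zeta|=2\pi r\sum_{k=1}^{mn+1}\frac{|R(\zeta_k)|^{2m}}{m\mu(\zeta_k)+1},\qquad \zeta_k=\zeta_k(m,\varphi).$$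
   Context: The degree of a rational function is the number of its poles in $\overline{\mathbb C}=\mathbb C\cup\{\infty\}$ counted with multiplicity. $|d\zeta|$ denotes integration with respect to arc length on $\gamma_r$.
   Formalization: The displayed equality ∑ n_k = n is taken as a condition on R: it fails when zeros of R cancel reflected poles (e.g. r=1, R(z)=z, where 𝓡=1 has no poles), and then the mn+1 notches do not exist. *)

(* Defs.v *)
From HB Require Import structures.
From mathcomp Require Import all_boot all_order all_algebra.
From mathcomp Require Import generic_quotient fraction.
From mathcomp Require Import complex.
From mathcomp Require Import all_classical all_reals all_analysis.

Set Implicit Arguments.
Unset Strict Implicit.
Unset Printing Implicit Defensive.

Import Order.TTheory GRing.Theory Num.Theory.

Local Open Scope ring_scope.
Local Open Scope complex_scope.

Section RationalFunctions.
Variable K : fieldType.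
Implicit Types (f : {fraction {poly K}}) (p q : {poly K}) (a : K).

(* [rf_num f / rf_den f] is a reduced form of [f], so that the roots of
   [rf_den f] are exactly the finite poles of [f], and evaluation is correct at
   removable singularities.  None of the notions below depends on the
   representative chosen by [repr]: see [rf_eval_frac], [pole_order_frac] and
   [pole_order_oo_frac]. *)
Definition rf_num f : {poly K} := (repr f).1 %/ gcdp (repr f).1 (repr f).2.
Definition rf_den f : {poly K} := (repr f).2 %/ gcdp (repr f).1 (repr f).2.

(* A junk value (division by zero) at the poles. *)
Definition rf_eval f a : K := (rf_num f).[a] / (rf_den f).[a].

Definition pole_order f a : nat := mup a (rf_den f).

(* The truncated subtraction makes this 0 when [f] is finite at infinity. *)
Definition pole_order_oo f : nat := (size (rf_num f) - size (rf_den f))%N.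

Definition rf_degree f : nat :=
  (\sum_(a \in [set: K]) pole_order f a + pole_order_oo f)%N.

Lemma rf_den_neq0 f : rf_den f != 0.
Proof.
have dn0 := denom_ratioP (repr f).
by rewrite dvdp_div_eq0 ?dvdp_gcdr.
Qed.

Lemma rf_coprime f : coprimep (rf_num f) (rf_den f).
Proof.
have dn0 := denom_ratioP (repr f).
by apply: coprimep_div_gcd; rewrite dn0 orbT.
Qed.

Lemma frac_cross p q p' q' : q != 0 -> q' != 0 ->
  FracField.tofrac p / FracField.tofrac q =
  FracField.tofrac p' / FracField.tofrac q' -> p * q' = p' * q.
Proof.
move=> q0 q'0 /eqP; rewrite eqr_div ?tofrac_eq0// -!tofracM tofrac_eq.
by move/eqP.
Qed.

Lemma frac_rfE f : f = FracField.tofrac (rf_num f) / FracField.tofrac (rf_den f).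
Proof.
have dn0 := denom_ratioP (repr f).
have fE : f = FracField.tofrac (repr f).1 / FracField.tofrac (repr f).2.
  apply: (canRL (mulfK _)); first by rewrite tofrac_eq0.
  rewrite -[X in X * _]reprK; unlock FracField.tofrac.
  rewrite -[LHS]FracField.pi_mul; apply/eqmodP.
  rewrite /= FracField.equivfE /FracField.mulf.
  by rewrite !numden_Ratio ?mulr1 ?oner_eq0// mulrC.
set g := gcdp (repr f).1 (repr f).2.
have g0 : g != 0 by rewrite gcdp_eq0 negb_and dn0 orbT.
have nE : (repr f).1 = rf_num f * g by rewrite divpK ?dvdp_gcdl.
have dE : (repr f).2 = rf_den f * g by rewrite divpK ?dvdp_gcdr.
rewrite [LHS]fE {1}nE {1}dE !tofracM -mulf_div divff ?mulr1//.
by rewrite tofrac_eq0.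
Qed.

Lemma rf_cross p q : q != 0 ->
  let f := FracField.tofrac p / FracField.tofrac q in
  p * rf_den f = rf_num f * q.
Proof.
by move=> q0 f; apply: frac_cross => //; [exact: rf_den_neq0|exact: frac_rfE].
Qed.

Lemma rf_eval_frac p q a : q.[a] != 0 ->
  rf_eval (FracField.tofrac p / FracField.tofrac q) a = p.[a] / q.[a].
Proof.
move=> qa; have q0 : q != 0 by apply: contraNneq qa => ->; rewrite horner0.
have /(congr1 (horner^~ a)) := rf_cross p q0; rewrite !hornerM.
set f := _ / _ => E; have da : (rf_den f).[a] != 0.
  apply/negP => /eqP d0; move: E; rewrite d0 mulr0 => /esym/eqP.
  rewrite mulf_eq0 (negPf qa) orbF => /(coprimep_root (rf_coprime f)).
  by rewrite d0 eqxx.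
by apply/eqP; rewrite /rf_eval eqr_div// -E.
Qed.

Lemma rf_reduced p q : q != 0 -> coprimep p q ->
  let f := FracField.tofrac p / FracField.tofrac q in
  exists2 c, c != 0 & rf_num f = c *: p /\ rf_den f = c *: q.
Proof.
move=> q0 cpq f; have E := rf_cross p q0; rewrite -/f in E.
have qd : q %| rf_den f.
  by rewrite -(@Gauss_dvdpr _ _ p) 1?coprimep_sym// E dvdp_mull.
have dq : rf_den f %| q.
  rewrite -(@Gauss_dvdpr _ _ (rf_num f)); first by rewrite -E dvdp_mull.
  by rewrite coprimep_sym rf_coprime.
have /eqpP[[c1 c2] /= /andP[c10 c20] e] : rf_den f %= q by apply/andP.
have d1 : rf_den f = (c1^-1 * c2) *: q.
  by rewrite -scalerA -e scalerA mulVf ?scale1r.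
exists (c1^-1 * c2); first by rewrite mulf_neq0 ?invr_eq0.
split => //; apply: (mulIf q0).
by rewrite -E d1 -scalerAr -scalerAl.
Qed.

Lemma pole_order_frac p q a : q != 0 -> coprimep p q ->
  pole_order (FracField.tofrac p / FracField.tofrac q) a = mup a q.
Proof.
move=> q0 cpq; have [c c0 [_ dE]] := rf_reduced q0 cpq.
by rewrite /pole_order dE -mul_polyC mupMr// rootC.
Qed.

Lemma pole_order_oo_frac p q : q != 0 -> coprimep p q ->
  pole_order_oo (FracField.tofrac p / FracField.tofrac q) =
  (size p - size q)%N.
Proof.
move=> q0 cpq; have [c c0 [nE dE]] := rf_reduced q0 cpq.
by rewrite /pole_order_oo nE dE !size_scale.
Qed.

Lemma exprVE (L : fieldType) (x : L) i N : x != 0 -> (i <= N)%N ->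
  x ^- i = x ^+ (N - i) / x ^+ N.
Proof.
move=> x0 iN; rewrite -[X in _ / x ^+ X](subnK iN) exprD invfM mulrA.
by rewrite divff ?mul1r// expf_neq0.
Qed.

End RationalFunctions.

Section Circle.
Variable R : realType.
Local Notation C := R[i].
Implicit Types (F : {fraction {poly C}}) (r t phi : R) (w : C).

(* Substitution of [r ^ 2 / X] in the polynomial with conjugate coefficients,
   that is, w |-> (p (r ^ 2 / w^* ))^* as a rational function of w. *)
Definition reflect_poly r (p : {poly C}) : {fraction {poly C}} :=
  (map_poly (fun c => FracField.tofrac (c^*)%:P) p).[
    FracField.tofrac (r%:C ^+ 2)%:P / FracField.tofrac 'X].

Definition reflect r F : {fraction {poly C}} :=
  reflect_poly r (rf_num F) / reflect_poly r (rf_den F).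

Definition calR r F : {fraction {poly C}} := F * reflect r F.

Lemma reflect_polyE r (p : {poly C}) N : (size p <= N)%N ->
  exists2 q : {poly C},
    reflect_poly r p = FracField.tofrac q / FracField.tofrac 'X^N &
    forall w, w != 0 -> q.[w] = w ^+ N * (p.[r%:C ^+ 2 / w^*])^*.
Proof.
move=> sN; pose c := r%:C ^+ 2.
have X0 : FracField.tofrac 'X != 0 :> {fraction {poly C}}.
  by rewrite tofrac_eq0 polyX_eq0.
exists (\sum_(i < N) ((p`_i)^* * c ^+ i)%:P * 'X^(N - i)) => [|w w0].
  rewrite /reflect_poly -/c; clearbody c.
  rewrite (@horner_coef_wide _ N) ?(leq_trans (size_poly _ _))//.
  rewrite raddf_sum/= mulr_suml; apply: eq_bigr => i _.
  rewrite coef_map_id0; last by rewrite rmorph0 polyC0 tofrac0.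
  rewrite polyCM !tofracM -!mulrA; congr (_ * _).
  rewrite exprMn exprVn polyC_exp !tofracXn; congr (_ * _).
  by rewrite -(exprVE X0 (ltnW (ltn_ord i))).
rewrite horner_sum (@horner_coef_wide _ N p)// rmorph_sum/= mulr_sumr.
apply: eq_bigr => i _.
rewrite hornerM hornerC hornerXn rmorphM/= -mulrA [RHS]mulrCA; congr (_ * _).
have cE : (c / w^*)^* = c / w.
  have cr : c^* = c by rewrite /c (rmorphXn (@conjc R)) /= oppr0.
  by rewrite (rmorphM (@conjc R)) [X in X * _]cr (fmorphV (@conjc R)) /= conjcK.
rewrite [RHS](_ : _ = w ^+ N * (c / w) ^+ i); last by rewrite -cE -(rmorphXn (@conjc R)).
clearbody c; rewrite exprMn exprVn mulrCA; congr (_ * _).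
by rewrite (exprVE w0 (ltnW (ltn_ord i))) mulrCA divff ?mulr1// expf_neq0.
Qed.

Lemma rf_eval_calR r F w : w != 0 ->
  (rf_den F).[w] != 0 -> (rf_den F).[r%:C ^+ 2 / w^*] != 0 ->
  rf_eval (calR r F) w = rf_eval F w * (rf_eval F (r%:C ^+ 2 / w^*))^*.
Proof.
move=> w0 d0 dr0; pose N := maxn (size (rf_num F)) (size (rf_den F)).
have [qn nE nw] := @reflect_polyE r (rf_num F) N (leq_maxl _ _).
have [qd dE dw] := @reflect_polyE r (rf_den F) N (leq_maxr _ _).
have XN0 : FracField.tofrac 'X^N != 0 :> {fraction {poly C}}.
  by rewrite tofrac_eq0 expf_neq0// polyX_eq0.
have E : calR r F =
    FracField.tofrac (rf_num F * qn) / FracField.tofrac (rf_den F * qd).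
  rewrite /calR /reflect nE dE [in LHS](frac_rfE F) !tofracM -[RHS]mulf_div.
  congr (_ * _); rewrite invfM invrK mulrACA mulVf ?mulr1//.
have wN0 : w ^+ N != 0 by rewrite expf_neq0.
have cdr0 : ((rf_den F).[r%:C ^+ 2 / w^*])^* != 0 by rewrite conjc_eq0.
rewrite E rf_eval_frac ?hornerM ?dw ?mulf_neq0// nw// -mulf_div.
congr (_ * _); rewrite -mulf_div divff// mul1r.
by rewrite /rf_eval rmorphM/= fmorphV.
Qed.

Definition expi t : C := cos t +i* sin t.

(* The integral of [g] with respect to arc length on the circle |w| = r, taken
   componentwise. *)
Definition arc_int r (g : C -> C) : C :=
  r%:C * ((\int[lebesgue_measure]_(t in `[0, 2 * pi])
             complex.Re (g (r%:C * expi t)))%R +i*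
          (\int[lebesgue_measure]_(t in `[0, 2 * pi])
             complex.Im (g (r%:C * expi t)))%R).

Section Nodes.
Variables (r : R) (nu : nat) (z : 'I_nu -> C) (nk : 'I_nu -> nat).

Definition blaschke w : C :=
  \prod_(k < nu) (r%:C * ((w - z k) / (r%:C ^+ 2 - w * (z k)^*))) ^+ nk k.

Definition muB w : C :=
  \sum_(k < nu) (nk k)%:R * (r%:C ^+ 2 - `|z k| ^+ 2) / `|w - z k| ^+ 2.

(* [zeta] enumerates without repetition the roots of w B(w)^m = r e^(i phi).
   At a pole of [B] the formal value of [blaschke] is 0 (division by zero), so
   that for [0 < m] no pole is counted as a root. *)
Definition notches m phi N (zeta : 'I_N -> C) : Prop :=
  injective zeta /\
  forall w, w * blaschke w ^+ m = r%:C * expi phi <-> exists k, w = zeta k.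

End Nodes.

End Circle.

(* Main.v *)
Require Import Defs.
From HB Require Import structures.
From mathcomp Require Import all_boot all_order all_algebra.
From mathcomp Require Import generic_quotient fraction.
From mathcomp Require Import complex.
From mathcomp Require Import all_classical all_reals all_analysis.
From mathcomp Require Import ring zify.

(* Put D(z) = prod_k (z - z_k)^(m n_k) and D#(z) = prod_k (r^2 - z z_k^bar)^(m n_k),
   N = m n, rho = r e^(i phi).  The nodes are the roots of
   E = r^N z D - rho D#, a polynomial of degree N + 1 whose roots are simple and
   lie on the circle, with z E'(z) = rho D#(z) (1 + m mu(z)) there.

   Since the n_k add up to n, the denominator q of R satisfies
   q q# = c D D# (for m = 1), where q# is the reciprocal polynomial, so that on
   the circle both R (m = 1) and |R|^(2m) are of the form T / (D D#) with
   deg T <= 2N.  By Bezout this is U / D + V / D# with deg U < N and deg V <= N.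
   The mean of U / D over the circle is 0 and that of V / D# is its value at 0.
   The weighted sums over the nodes give the same: they are
   r^N sum_k U(zeta_k) / E'(zeta_k) and
   rho sum_k V(zeta_k) / (zeta_k E'(zeta_k)), which Lagrange interpolation at the
   roots of E evaluates (leading coefficient, value at 0). *)

Set Implicit Arguments.
Unset Strict Implicit.
Unset Printing Implicit Defensive.

Import Order.TTheory GRing.Theory Num.Theory.
Import numFieldNormedType.Exports.

Local Open Scope ring_scope.
Local Open Scope complex_scope.

(** * Integrals of complex-valued functions *)

Section ComplexIntegral.
(* With [complex_scope] on top, [x^*] would be [conjc x] or [Num.conj x]
   depending on its position; here it is always [Num.conj x]. *)
Local Open Scope ring_scope.
Variable R : realType.
Local Notation C := R[i].
Local Notation mu := (@lebesgue_measure R).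
Implicit Types (f g : R -> C) (c : C).

Definition ccontinuous g :=
  continuous (fun t : R => complex.Re (g t)) /\
  continuous (fun t : R => complex.Im (g t)).

Lemma ccontinuous_cst c : ccontinuous (fun=> c).
Proof. by split => t; exact: cvg_cst. Qed.

Lemma eq_ccontinuous f g : f =1 g -> ccontinuous f -> ccontinuous g.
Proof. by move=> /funext ->. Qed.

Lemma ccontinuousD f g :
  ccontinuous f -> ccontinuous g -> ccontinuous (fun t => f t + g t).
Proof.
move=> [f1 f2] [g1 g2]; split => t.
- rewrite (_ : (fun t => _) = fun t => complex.Re (f t) + complex.Re (g t)).
    by apply: cvgD; [exact: f1|exact: g1].
  by apply/funext => u; case: (f u) (g u) => [? ?] [].
- rewrite (_ : (fun t => _) = fun t => complex.Im (f t) + complex.Im (g t)).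
    by apply: cvgD; [exact: f2|exact: g2].
  by apply/funext => u; case: (f u) (g u) => [? ?] [].
Qed.

Lemma ccontinuousM f g :
  ccontinuous f -> ccontinuous g -> ccontinuous (fun t => f t * g t).
Proof.
move=> [f1 f2] [g1 g2]; split => t.
- rewrite (_ : (fun t => _) = fun t => complex.Re (f t) * complex.Re (g t)
                                     - complex.Im (f t) * complex.Im (g t)).
    by apply: cvgB; apply: cvgM; [exact: f1|exact: g1|exact: f2|exact: g2].
  by apply/funext => u; case: (f u) (g u) => [? ?] [].
- rewrite (_ : (fun t => _) = fun t => complex.Re (f t) * complex.Im (g t)
                                     + complex.Im (f t) * complex.Re (g t)).
    by apply: cvgD; apply: cvgM; [exact: f1|exact: g2|exact: f2|exact: g1].
  by apply/funext => u; case: (f u) (g u) => [? ?] [].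
Qed.

Lemma ccontinuousV f :
  (forall t, f t != 0) -> ccontinuous f -> ccontinuous (fun t => (f t)^-1).
Proof.
move=> f0 [f1 f2].
(* [d] is the squared modulus; the inverse is the conjugate divided by it. *)
pose d t := complex.Re (f t) * complex.Re (f t) + complex.Im (f t) * complex.Im (f t).
have d0 t : d t != 0.
  rewrite /d -!expr2 paddr_eq0 ?sqr_ge0// !sqrf_eq0.
  by have := f0 t; rewrite eq_complex.
have dc t : {for t, continuous (fun t => (d t)^-1)}.
  apply: cvgV; first exact: d0.
  rewrite /d; apply: cvgD; apply: cvgM.
  - exact: f1.
  - exact: f1.
  - exact: f2.
  - exact: f2.
split => t.
- rewrite (_ : (fun t => _) = fun t => complex.Re (f t) * (d t)^-1).
    by apply: cvgM; [exact: f1|exact: dc].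
  by apply/funext => u; rewrite /d -!expr2; case: (f u).
- rewrite (_ : (fun t => _) = fun t => - (complex.Im (f t) * (d t)^-1)).
    by apply: cvgN; apply: cvgM; [exact: f2|exact: dc].
  by apply/funext => u; rewrite /d -!expr2; case: (f u).
Qed.

Lemma ccontinuous_horner (p : {poly C}) f :
  ccontinuous f -> ccontinuous (fun t => p.[f t]).
Proof.
move=> fc; elim/poly_ind: p => [|p c pc].
  by apply: eq_ccontinuous (ccontinuous_cst 0) => t; rewrite horner0.
apply: (@eq_ccontinuous (fun t => p.[f t] * f t + c)) => [t|].
  by rewrite hornerMXaddC.
by apply: ccontinuousD (ccontinuous_cst _); exact: ccontinuousM.
Qed.

Lemma ccontinuous_expi : ccontinuous (@expi R).
Proof. by split; [exact: continuous_cos|exact: continuous_sin]. Qed.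

Definition cint g : C :=
  (\int[mu]_(t in `[0, 2 * pi]) complex.Re (g t))%R +i*
  (\int[mu]_(t in `[0, 2 * pi]) complex.Im (g t))%R.

Lemma eq_cint f g : f =1 g -> cint f = cint g.
Proof. by move=> /funext ->. Qed.

Lemma integrable_cont (h : R -> R) a b : continuous h ->
  mu.-integrable `[a, b] (EFin \o h).
Proof.
move=> hc; apply: continuous_compact_integrable; first exact: segment_compact.
exact: continuous_subspaceT.
Qed.

Lemma cintD f g : ccontinuous f -> ccontinuous g ->
  cint (fun t => f t + g t) = cint f + cint g.
Proof.
move=> [f1 f2] [g1 g2]; rewrite /cint.
apply/eqP; rewrite eq_complex/= -!RintegralD//; try exact: integrable_cont.
apply/andP; split; apply/eqP; apply: eq_Rintegral => u _;
by case: (f u) (g u) => [? ?] [].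
Qed.

Lemma cintZ c f : ccontinuous f -> cint (fun t => c * f t) = c * cint f.
Proof.
move=> [f1 f2]; rewrite /cint; case: c => x y.
have ZR (h : R -> R) a : continuous h -> continuous (fun t : R => a * h t).
  by move=> hc t; apply: cvgM; [exact: cvg_cst|exact: hc].
apply/eqP; rewrite eq_complex/= -!RintegralZl//; try exact: integrable_cont.
rewrite -RintegralD -?RintegralB//; try (apply: integrable_cont; exact: ZR).
by apply/andP; split; apply/eqP; apply: eq_Rintegral => u _; case: (f u).
Qed.

Lemma cintJ f : ccontinuous f -> cint (fun t => (f t)^*) = (cint f)^*.
Proof.
move=> [f1 f2]; rewrite /cint.
have -> u v : (u +i* v : C)^* = u +i* (- v) by [].
apply/eqP; rewrite eq_complex/=; apply/andP; split; apply/eqP.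
  by apply: eq_Rintegral => u _; case: (f u).
rewrite -mulN1r -RintegralZl//; last exact: integrable_cont.
by apply: eq_Rintegral => u _; case: (f u) => x y; rewrite mulN1r.
Qed.

Lemma lebesgue_measure_segment (a b : R) : a <= b -> mu `[a, b] = (b - a)%:E.
Proof.
rewrite le_eqVlt => ab; have := lebesgue_measure_itv `[a, b] => ->/=.
by rewrite lte_fin; case/predU1P: ab => [->|->//]; rewrite ltxx subrr.
Qed.

Lemma normr_Rintegral_le (h : R -> R) (a b M : R) : a <= b ->
  continuous h -> {in `[a, b], forall t, `|h t| <= M} ->
  `| \int[mu]_(t in `[a, b]) h t | <= M * (b - a).
Proof.
move=> ab hc hM.
apply: (le_trans (le_normr_Rintegral _ _)) => //; first exact: integrable_cont.
have -> : M * (b - a) = \int[mu]_(t in `[a, b]) M.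
  rewrite Rintegral_cst//; congr (_ * _).
  exact/esym/(congr1 fine (lebesgue_measure_segment ab)).
apply: le_Rintegral => //.
- by apply: integrable_cont => t; apply: (@cvg_norm _ R^o); exact: hc.
- by apply: integrable_cont => t; exact: cvg_cst.
Qed.

(** The constant [M] is fixed by [g] alone, before [f] and [K]. One [M] then serves all the products
    of [g] with powers of [w], with [K] a power of [r]. *)
Lemma normr_cint_le g : ccontinuous g ->
  exists M : R, forall f, ccontinuous f ->
  forall K : R, (forall t, `|f t| <= K%:C * `|g t|) -> `|cint f| <= (K * M)%:C.
Proof.
move=> gc; pose h t := `|complex.Re (g t)| + `|complex.Im (g t)|.
have p0 : (0 : R) <= 2 * pi by rewrite mulr_ge0 ?pi_ge0.
have hc : {within `[0, 2 * pi], continuous h}%classic.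
  apply: continuous_subspaceT => t.
  by apply: cvgD; apply: (@cvg_norm _ R^o); [exact: gc.1|exact: gc.2].
have [c _ hM] := EVT_max p0 hc.
exists (h c * (4 * pi)) => f [f1 f2] K fK.
have normi : `|'i%C : C| = 1 by rewrite normc_def/= expr0n/= expr1n add0r sqrtr1.
have gh t : `|g t| <= (h t)%:C.
  rewrite [X in `|X|]complexE; apply: (le_trans (ler_normD _ _)).
  by rewrite normrM normi mul1r !normc_def/= !expr0n/= !addr0 !sqrtr_sqr -rmorphD.
(* A negative [K] forces [g] to vanish, and then both sides of the bound are 0. *)
have K0 : 0 <= K \/ forall t, g t = 0.
  have [|K0] := leP 0 K; [by left|right] => t; apply/eqP.
  have := le_trans (normr_ge0 _) (fK t).
  by rewrite -normr_le0 nmulr_rge0// ltcR.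
have fh t : t \in `[0, 2 * pi] -> `|f t| <= (K * h c)%:C.
  move=> t01; apply: (le_trans (fK t)).
  case: K0 => [K0|g0].
    rewrite rmorphM/= ler_wpM2l ?ler0c//.
    by apply: (le_trans (gh t)); rewrite lecR hM.
  have -> : h c = 0 by rewrite /h g0 normr0 addr0.
  by rewrite g0 normr0 !mulr0.
have b1 := @normr_Rintegral_le _ 0 (2 * pi) (K * h c) p0 f1.
have b2 := @normr_Rintegral_le _ 0 (2 * pi) (K * h c) p0 f2.
rewrite /cint [X in `|X|]complexE.
apply: (le_trans (ler_normD _ _)).
rewrite normrM normi mul1r !normc_def/= !expr0n/= !addr0 !sqrtr_sqr -rmorphD/=.
rewrite lecR.
have -> : K * (h c * (4 * pi)) = K * h c * (2 * pi - 0) + K * h c * (2 * pi - 0).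
  by ring.
apply: lerD.
- apply: b1 => t t01; have := le_trans (normc_ge_Re (f t)) (fh t t01).
  by rewrite lecR.
(* The imaginary part is read off as minus the real part of [f t * 'i]. *)
- apply: b2 => t t01; have := le_trans (normc_ge_Re (f t * 'i)) _.
  by rewrite normrM normi mulr1 ReiNIm normrN => /(_ _ (fh t t01)); rewrite lecR.
Qed.

Lemma expiX k t : @expi R t ^+ k = expi (k%:R * t).
Proof.
elim: k => [|k IH]; first by rewrite expr0 mul0r /expi cos0 sin0.
rewrite exprS IH -natr1 mulrDl mul1r /expi cosD sinD.
by apply/eqP; rewrite eq_complex/=; apply/andP; split; apply/eqP; ring.
Qed.

Lemma normr_expi t : `|@expi R t| = 1.
Proof. by rewrite normc_def/= cos2Dsin2 sqrtr1. Qed.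

Lemma cint_cst c : cint (fun=> c) = (2 * pi)%:C * c.
Proof.
have p0 : (0 : R) <= 2 * pi by rewrite mulr_ge0 ?pi_ge0.
have e (x : R) : (\int[mu]_(t in `[0, 2 * pi]) x)%R = 2 * pi * x.
  rewrite Rintegral_cst// mulrC; congr (_ * _).
  by have /(congr1 fine) := lebesgue_measure_segment p0; rewrite subr0.
rewrite /cint !e; case: c => x y.
by apply/eqP; rewrite eq_complex/= !mul0r subr0 addr0 !eqxx.
Qed.

Lemma is_derive_scaled (f : R -> R) (df : R) (k x : R) :
  is_derive (k * x) (1:R) f df -> is_derive x (1:R) (fun t => f (k * t)) (k * df).
Proof.
move=> Hf.
have Hk : is_derive x (1:R) (fun t => k * t) k.
  have := @is_deriveZ R R^o R^o id k x 1 1 _.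
  by rewrite /GRing.scale/= mulr1; apply.
by have := @is_derive1_comp R f (fun t => k * t) x df k Hf Hk; rewrite mulrC.
Qed.

Lemma FTC_periodic (F f : R -> R) : continuous f ->
  (forall x, is_derive x (1:R) F (f x)) -> F (2 * pi) = F 0 ->
  (\int[mu]_(t in `[0, 2 * pi]) f t)%R = 0.
Proof.
move=> fc Fd FE; have p0 : (0:R) < 2 * pi by rewrite mulr_gt0 ?pi_gt0.
have Fc : continuous F.
  by move=> x; apply/differentiable_continuous/derivable1_diffP; apply: ex_derive.
rewrite /Rintegral (@continuous_FTC2 _ f F)//.
- by rewrite FE -EFinB subrr.
- exact: continuous_subspaceT.
- split => [x _| |].
  + by apply: ex_derive.
  + by apply: cvg_at_right_filter; exact: Fc.
  + by apply: cvg_at_left_filter; exact: Fc.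
- by move=> x _; rewrite derive1E; apply: derive_val.
Qed.

Lemma cint_expiX k : (0 < k)%N -> cint (fun t => expi t ^+ k) = 0.
Proof.
move=> k0; have kR : (k%:R : R) != 0 by rewrite pnatr_eq0 -lt0n.
have per u : (u%:R * (2 * pi) : R) = 0 + (pi *+ 2) *+ u.
  by rewrite add0r !mulr_natl.
have mc (h : R -> R) : continuous h -> continuous (fun t : R => h (k%:R * t)).
  move=> hc t; apply: (@continuous_comp _ _ _ (fun t : R => k%:R * t) h).
    by apply: cvgM; [exact: cvg_cst|exact: cvg_id].
  exact: hc.
under eq_cint do rewrite expiX.
apply/eqP; rewrite eq_complex/=; apply/andP; split; apply/eqP.
- apply: (@FTC_periodic (fun t => k%:R^-1 * sin (k%:R * t))).
  + by apply: (mc cos); exact: continuous_cos.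
  + move=> x; have H := @is_derive_scaled sin _ k%:R x (is_derive_sin _).
    have := @is_deriveZ R R^o R^o _ k%:R^-1 x 1 _ H.
    by rewrite /GRing.scale/= mulrA mulVf// mul1r.
  + by rewrite mulr0 per (periodicn (@sinD2pi R)).
- apply: (@FTC_periodic (fun t => - k%:R^-1 * cos (k%:R * t))).
  + by apply: (mc sin); exact: continuous_sin.
  + move=> x; have H := @is_derive_scaled cos _ k%:R x (is_derive_cos _).
    have := @is_deriveZ R R^o R^o _ (- k%:R^-1) x 1 _ H.
    by rewrite /GRing.scale/= mulNr mulrA mulVf// mul1r opprK.
  + by rewrite mulr0 per (periodicn (@cosD2pi R)).
Qed.

End ComplexIntegral.

(** * Means over the circle *)

Section CircleMeans.
Local Open Scope ring_scope.
Variables (R : realType) (r : R).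
Hypothesis r0 : 0 < r.
Local Notation C := R[i].
Local Notation w t := (r%:C * expi t).
Implicit Types (g h : R -> C) (a : C) (p : {poly C}).

Lemma ccontinuous_circle : ccontinuous (fun t => w t).
Proof. exact: ccontinuousM (ccontinuous_cst _) (ccontinuous_expi _). Qed.

Lemma normr_circle t : `|w t| = r%:C.
Proof. by rewrite normrM normr_expi mulr1 ger0_norm// ler0c ltW. Qed.

(** The mean value property: positive powers of [w t] integrate to 0, so only the constant
    coefficient survives. *)
Lemma cint_horner p : cint (fun t => p.[w t]) = (2 * pi)%:C * p.[0].
Proof.
elim/poly_ind: p => [|p c IH].
  by under eq_cint do rewrite horner0; rewrite cint_cst horner0.
(* Stated for every [m > 0], because peeling off a coefficient of [q] raises the power of [w t] by
   one. *)
have pw m q : (0 < m)%N -> cint (fun t => q.[w t] * w t ^+ m) = 0.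
  elim/poly_ind: q m {p c IH} => [|q c IH] m m0.
    by under eq_cint do rewrite horner0 mul0r; rewrite cint_cst mulr0.
  under eq_cint do rewrite hornerMXaddC mulrDl -mulrA -exprS.
  have c1 : ccontinuous (fun t => q.[w t] * w t ^+ m.+1).
    apply: (@eq_ccontinuous R (fun t => (q * 'X^(m.+1)).[w t])).
      by move=> t; rewrite hornerM hornerXn.
    exact/ccontinuous_horner/ccontinuous_circle.
  have c2 : ccontinuous (fun t => c * w t ^+ m).
    apply: (@eq_ccontinuous R (fun t => (c%:P * 'X^m).[w t])).
      by move=> t; rewrite hornerM hornerC hornerXn.
    exact/ccontinuous_horner/ccontinuous_circle.
  rewrite cintD//.
  rewrite IH// add0r.
  under eq_cint do rewrite exprMn mulrA.
  rewrite cintZ ?cint_expiX ?mulr0//.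
  apply: (@eq_ccontinuous R (fun t => ('X^m).[expi t])).
    by move=> t; rewrite hornerXn.
  exact/ccontinuous_horner/ccontinuous_expi.
under eq_cint do rewrite hornerMXaddC -[X in _ * X]expr1.
rewrite cintD.
- by rewrite pw// add0r cint_cst hornerMXaddC mulr0 add0r.
- apply: ccontinuousM; last exact: ccontinuous_circle.
  exact/ccontinuous_horner/ccontinuous_circle.
- exact: ccontinuous_cst.
Qed.

Lemma le_geometric_eq0 (x K q : R) : 0 <= q < 1 -> 0 <= x ->
  (forall j, x <= q ^+ j * K) -> x = 0.
Proof.
move=> /andP[q0 q1] x0 H; apply/eqP; rewrite eq_le x0 andbT.
have c : (q ^+ j * K @[j --> \oo] --> (0 : R))%classic.
  have := @cvgM _ _ _ _ (fun j => q ^+ j) (fun=> K) 0 K.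
  rewrite mul0r; apply; last exact: cvg_cst.
  by apply: cvg_expr; rewrite ger0_norm.
rewrite -(cvg_lim (@Rhausdorff R) c); apply: limr_ge; first by apply/cvg_ex; exists 0.
by apply: nearW.
Qed.

Lemma reflected_neq0 a t : `|a| < r%:C -> r%:C ^+ 2 - a^* * w t != 0.
Proof.
move=> ar; rewrite subr_eq0; apply/eqP => /(congr1 Num.norm)/eqP.
rewrite [X in X == _]normrX [X in _ == X]normrM normr_circle norm_conjC.
rewrite ger0_norm ?ler0c 1?ltW// expr2.
rewrite -subr_eq0 -mulrBl mulf_eq0 subr_eq0 (gt_eqF ar) /=.
by rewrite gt_eqF// (ltcR 0).
Qed.

(* [J_k := cint (h * w ^ k)] satisfies [r ^ 2 * J_k = a^* * J_(k+1)] and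
   [J_k = O(r ^ k)], so that [J_k] is bounded by a multiple of
   [(|a| / r) ^ j] for all [j]. *)
Lemma cint_div_reflected g a : ccontinuous g -> `|a| < r%:C ->
  (forall k, (0 < k)%N -> cint (fun t => g t * w t ^+ k) = 0) ->
  let h t := g t / (r%:C ^+ 2 - a^* * w t) in
  [/\ ccontinuous h,
      forall k, (0 < k)%N -> cint (fun t => h t * w t ^+ k) = 0 &
      cint h = cint g / r%:C ^+ 2].
Proof.
move=> gc ar g0 h.
have wc := ccontinuous_circle.
have wX k : ccontinuous (fun t => w t ^+ k).
  apply: (@eq_ccontinuous R (fun t => ('X^k).[w t])) => [t|].
    by rewrite hornerXn.
  exact: ccontinuous_horner.
have hc : ccontinuous h.
  apply: ccontinuousM => //; apply: ccontinuousV => [t|].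
    exact: reflected_neq0.
  apply: (@eq_ccontinuous R (fun t => r%:C ^+ 2 + - a^* * w t)) => [t|].
    by rewrite mulNr.
  by apply: ccontinuousD; [|apply: ccontinuousM]; try exact: ccontinuous_cst.
have rC0 : r%:C != 0 by rewrite gt_eqF// (ltcR 0).
have hwc k : ccontinuous (fun t => h t * w t ^+ k) by exact: ccontinuousM.
have rec k : r%:C ^+ 2 * cint (fun t => h t * w t ^+ k) =
    cint (fun t => g t * w t ^+ k) + a^* * cint (fun t => h t * w t ^+ k.+1).
  rewrite -!cintZ// -cintD; [|exact: ccontinuousM|]; last first.
    by apply: ccontinuousM => //; exact: ccontinuous_cst.
  apply: eq_cint => t; rewrite /h (exprS (w t)).
  have := reflected_neq0 t ar; set d := _ - _ => d0.
  set u := g t / d; have -> : g t = u * d by rewrite /u divfK.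
  by rewrite /d; ring.
have J0 k : (0 < k)%N -> cint (fun t => h t * w t ^+ k) = 0.
  move=> k0.
  have [A AE] : exists A : R, `|a| = A%:C.
    by exists (Num.sqrt (complex.Re a ^+ 2 + complex.Im a ^+ 2)); rewrite normc_def.
  have A0 : 0 <= A by rewrite -ler0c -AE.
  have Ar : A < r by rewrite -ltcR -AE.
  have [M HM] := normr_cint_le hc.
  have bnd j : `|cint (fun t => h t * w t ^+ j)| <= (r ^+ j * M)%:C.
    apply: HM => // t.
    by rewrite normrM normrX normr_circle mulrC rmorphXn.
  have iter j : cint (fun t => h t * w t ^+ k) =
      (a^* / r%:C ^+ 2) ^+ j * cint (fun t => h t * w t ^+ (k + j)).
    elim: j => [|j ->]; first by rewrite mul1r addn0.
    rewrite (exprSr _ j) -mulrA; congr (_ * _).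
    have := rec (k + j)%N; rewrite g0 ?addn_gt0 ?k0// add0r => e.
    by rewrite addnS mulrAC -e mulrC mulKf// expf_neq0.
  apply/eqP; rewrite -normr_eq0.
  pose x := complex.Re `|cint (fun t => h t * w t ^+ k)|.
  have xE : `|cint (fun t => h t * w t ^+ k)| = x%:C.
    by rewrite /x RRe_real// normr_real.
  rewrite xE; have -> : x = 0; last by [].
  apply: (@le_geometric_eq0 _ (r ^+ k * M) (A / r)).
  - by rewrite divr_ge0 ?(ltW r0)//= ltr_pdivrMr ?mul1r.
  - by rewrite -ler0c -xE.
  - move=> j; rewrite -lecR -xE (iter j) normrM normrX normrM.
    rewrite normfV normrX norm_conjC AE.
    rewrite (ger0_norm (x := r%:C)) ?ler0c ?(ltW r0)//.
    have -> : ((A / r) ^+ j * (r ^+ k * M))%:C =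
        (A%:C / r%:C ^+ 2) ^+ j * (r ^+ (k + j) * M)%:C.
      rewrite -!(rmorphXn, fmorphV, rmorphM)/=; congr (_%:C).
      rewrite exprD !exprMn !exprVn -exprM mulnC exprM expr2 invfM -!mulrA.
      congr (_ * (_ * _)); rewrite [RHS]mulrCA; congr (_ * _).
      by rewrite mulrA mulVf ?mul1r// expf_neq0// gt_eqF.
    by rewrite ler_wpM2l// exprn_ge0// divr_ge0 ?ler0c// exprn_ge0// ler0c ltW.
split => //.
(* The recurrence at [k = 0]: the term with [J_1] vanishes, which leaves [r ^ 2 * J_0] equal to the
   integral of [g]. *)
have := rec 0; rewrite (J0 1%N)// mulr0 addr0.
have -> : cint (fun t => g t * w t ^+ 0) = cint g.
  by apply: eq_cint => t; rewrite mulr1.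
have -> : cint (fun t => h t * w t ^+ 0) = cint h.
  by apply: eq_cint => t; rewrite mulr1.
by move=> <-; rewrite mulrC mulKf// expf_neq0.
Qed.

(** The factors are divided out one at a time. The vanishing of all positive moments is carried
    along because [cint_div_reflected] both requires and returns it. Each factor has value [r ^ 2]
    at the origin, whence the exponent [2 * size s]. *)
Lemma cint_prod_reflected p (s : seq C) : all (fun a => `|a| < r%:C) s ->
  let h t := p.[w t] / \prod_(a <- s) (r%:C ^+ 2 - a^* * w t) in
  [/\ ccontinuous h,
      forall k, (0 < k)%N -> cint (fun t => h t * w t ^+ k) = 0 &
      cint h = (2 * pi)%:C * p.[0] / r%:C ^+ (2 * size s)].
Proof.
elim: s => [|a s IH] /=.
  have e : (fun t => p.[w t] / \prod_(a <- [::]) (r%:C ^+ 2 - a^* * w t)) =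
      fun t => p.[w t].
    by apply/funext => t; rewrite big_nil divr1.
  rewrite e => _; split.
  - exact/ccontinuous_horner/ccontinuous_circle.
  - move=> k k0; rewrite (@eq_cint _ _ (fun t => (p * 'X^k).[w t])) => [|t].
      by rewrite cint_horner hornerM hornerXn expr0n gtn_eqF// !mulr0.
    by rewrite big_nil divr1 hornerM hornerXn.
  - by rewrite cint_horner muln0 expr0 divr1.
move=> /andP[ar /IH[h1 h2 h3]].
have [h4 h5 h6] := cint_div_reflected h1 ar h2.
have e t : p.[w t] / \prod_(b <- a :: s) (r%:C ^+ 2 - b^* * w t) =
    p.[w t] / \prod_(b <- s) (r%:C ^+ 2 - b^* * w t) / (r%:C ^+ 2 - a^* * w t).
  by rewrite big_cons invfM [_^-1 * _]mulrC mulrA.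
split.
- exact: eq_ccontinuous h4.
- by move=> k k0; rewrite -[RHS](h5 k k0); apply: eq_cint => t; rewrite e.
- by rewrite (eq_cint e) [LHS]h6 h3 -mulrA -invfM -exprD mulnSr.
Qed.

End CircleMeans.

(** * Interpolation and the node polynomial *)

Section Interpolation.
Variables (K : fieldType) (I : finType) (x : I -> K).
Hypothesis x_inj : injective x.
Local Notation P := (\prod_i ('X - (x i)%:P)).
Local Notation Pd i := (\prod_(j | j != i) ('X - (x j)%:P)).

(** Divided by the derivative of [P] at [x i], the product omitting [i] is thus the Lagrange basis
    polynomial of that node. *)
Lemma horner_prod_XsubC_neq i j : (Pd i).[x j] = P^`().[x i] *+ (i == j).
Proof.
have E k : P = ('X - (x k)%:P) * Pd k by rewrite (bigD1 k).
have -> : P^`().[x i] = (Pd i).[x i].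
  by rewrite (E i) derivM hornerD !hornerM derivXsubC !hornerE subrr mul0r addr0.
have [->//|nij] := eqVneq i j.
by rewrite (bigD1 j) 1?eq_sym//= hornerM hornerXsubC subrr mul0r.
Qed.

Lemma deriv_prod_XsubC_neq0 i : P^`().[x i] != 0.
Proof.
have := horner_prod_XsubC_neq i i; rewrite eqxx mulr1n => <-.
rewrite horner_prod prodf_seq_neq0; apply/allP => j _; apply/implyP => nji.
by rewrite hornerXsubC subr_eq0 (inj_eq x_inj) eq_sym.
Qed.

Lemma size_prod_XsubC_neq i : size (Pd i) = #|I|.
Proof.
rewrite -big_filter size_prod_XsubC size_filter -sum1_count sum1_card.
by rewrite (cardC1 i) prednK//; apply/card_gt0P; exists i.
Qed.

(** The difference of the two sides has degree less than [#|I|] and vanishes at [#|I|] distinct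
    nodes. *)
Lemma poly_interpolation (u : {poly K}) : (size u <= #|I|)%N ->
  u = \sum_i (u.[x i] / P^`().[x i]) *: Pd i.
Proof.
move=> su; apply/eqP; rewrite -subr_eq0; apply/eqP.
apply: (@roots_geq_poly_eq0 _ _ (codom x)).
- apply/allP => _ /codomP[j ->]; apply/rootP; rewrite hornerD hornerN horner_sum.
  rewrite (bigD1 j)//= [X in _ - (_ + X)]big1 ?addr0 => [|i nij].
    rewrite hornerZ horner_prod_XsubC_neq eqxx mulr1n divfK ?subrr//.
    exact: deriv_prod_XsubC_neq0.
  by rewrite hornerZ horner_prod_XsubC_neq (negPf nij) mulr0n mulr0.
- by rewrite map_inj_uniq ?enum_uniq.
- rewrite size_codom; apply: (leq_trans (size_polyD _ _)).
  rewrite geq_max su size_polyN; apply: (leq_trans (size_sum _ _ _)).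
  apply/bigmax_leqP => i _; apply: (leq_trans (size_scale_leq _ _)).
  by rewrite size_prod_XsubC_neq.
Qed.

(** Compare the coefficients of degree [#|I| - 1] in the interpolation formula: [u] has none, and
    each basis product is monic of exactly that degree. *)
Lemma sum_div_deriv_eq0 (u : {poly K}) : (size u < #|I|)%N ->
  \sum_i u.[x i] / P^`().[x i] = 0.
Proof.
move=> su; have := poly_interpolation (ltnW su).
move=> /(congr1 (fun p : {poly K} => p`_(#|I|.-1))).
rewrite [LHS]nth_default; last by case: #|I| su.
move=> e; rewrite [RHS]e coef_sum; apply: eq_bigr => i _.
rewrite coefZ -(size_prod_XsubC_neq i) -lead_coefE.
by rewrite (monicP (monic_prod_XsubC _ _ _)) mulr1.
Qed.

(** The interpolation formula evaluated at 0, where the product omitting [i] has value [- P.[0] / x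
    i]. *)
Lemma sum_div_deriv (u : {poly K}) : (forall i, x i != 0) ->
  (size u <= #|I|)%N ->
  \sum_i u.[x i] / (x i * P^`().[x i]) = - (u.[0] / P.[0]).
Proof.
move=> x0 su; rewrite [X in X.[0] / _](poly_interpolation su).
rewrite horner_sum mulr_suml -sumrN.
apply: eq_bigr => i _; rewrite hornerZ.
have Pd0 : (Pd i).[0] != 0.
  rewrite horner_prod prodf_seq_neq0; apply/allP => j _; apply/implyP => _.
  by rewrite hornerXsubC sub0r oppr_eq0.
rewrite [in P.[0]](bigD1 i)//= hornerM hornerXsubC sub0r.
have := deriv_prod_XsubC_neq0 i; set d := P^`().[_] => d0.
by field; rewrite d0 x0 oppr_eq0 x0 Pd0.
Qed.

End Interpolation.

(** The logarithmic derivative of a product. *)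
Lemma horner_deriv_prod (K : fieldType) (I : eqType) (s : seq I)
    (f : I -> {poly K}) (x : K) :
  {in s, forall i, (f i).[x] != 0} ->
  (\prod_(i <- s) f i)^`().[x] =
    (\prod_(i <- s) f i).[x] * \sum_(i <- s) (f i)^`().[x] / (f i).[x].
Proof.
elim: s => [|a s IH] f0; first by rewrite !big_nil derivC horner0 mulr0.
rewrite !big_cons derivM hornerD !hornerM IH => [|i si]; last first.
  by rewrite f0// inE si orbT.
have := f0 a; rewrite inE eqxx => /(_ isT) fa0.
by field.
Qed.

Lemma prodr_const_seq (K : pzRingType) (I : Type) (s : seq I) (c : K) :
  \prod_(i <- s) c = c ^+ size s.
Proof. by rewrite big_const_seq count_predT iter_mulr_1. Qed.

(** The origin is excluded because the values of reciprocal polynomials are known through a division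
    by [w]. Enough positive integers remain as test points. *)
Lemma eq_poly_neq0 (K : numDomainType) (p q : {poly K}) :
  (forall w, w != 0 -> p.[w] = q.[w]) -> p = q.
Proof.
move=> pq; apply/eqP; rewrite -subr_eq0; apply/eqP.
apply: (@roots_geq_poly_eq0 _ _ [seq i.+1%:R | i <- iota 0 (size (p - q))]).
- apply/allP => _ /mapP[i _ ->]; apply/rootP.
  by rewrite hornerD hornerN pq ?subrr// pnatr_eq0.
- by rewrite map_inj_uniq ?iota_uniq// => i j /eqP; rewrite eqr_nat => /eqP[].
- by rewrite size_map size_iota.
Qed.

(** * Blaschke factors and the roots of the node polynomial *)

Section Nodes.
Local Open Scope ring_scope.
Variables (R : realType) (r : R).
Hypothesis r0 : 0 < r.
Local Notation C := R[i].
Implicit Types (a w rho : C) (s : seq C) (p : {poly C}).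

Definition zero_poly s : {poly C} := \prod_(a <- s) ('X - a%:P).
(** The zeros are the reflections of the points of [s] in the circle. The factors are not made
    monic, so that [a = 0], whose reflection is infinity, contributes the constant [r ^ 2]. *)
Definition reflected_poly s : {poly C} :=
  \prod_(a <- s) ((r%:C ^+ 2)%:P - a^* *: 'X).
(** The equation [z B(z) = rho] with denominators cleared, [B] being the Blaschke product with zeros
    [s]. *)
Definition node_poly s rho : {poly C} :=
  r%:C ^+ size s *: ('X * zero_poly s) - rho *: reflected_poly s.
(** For [w] on the circle the summands are Poisson kernels. *)
Definition poisson_sum s w : C :=
  \sum_(a <- s) (r%:C ^+ 2 - `|a| ^+ 2) / `|w - a| ^+ 2.

Let rC_gt0 : 0 < r%:C. Proof. by rewrite (ltcR 0). Qed.
Let rC_real : r%:C \is Num.real. Proof. by rewrite realE ltW. Qed.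
Let rC_neq0 : r%:C != 0. Proof. by rewrite gt_eqF. Qed.

Lemma conj_real (a : R) : (a%:C)^* = a%:C.
Proof. exact: conjc_real. Qed.

Lemma conj_sqr_real : (r%:C ^+ 2)^* = r%:C ^+ 2.
Proof. by rewrite rmorphXn/= conj_real. Qed.

Lemma horner_zero_poly s w : (zero_poly s).[w] = \prod_(a <- s) (w - a).
Proof. by rewrite horner_prod; apply: eq_bigr => a _; rewrite hornerXsubC. Qed.

Lemma horner_reflected_poly s w :
  (reflected_poly s).[w] = \prod_(a <- s) (r%:C ^+ 2 - a^* * w).
Proof. by rewrite horner_prod; apply: eq_bigr => a _; rewrite !hornerE. Qed.

Lemma size_zero_poly s : size (zero_poly s) = (size s).+1.
Proof. exact: size_prod_XsubC. Qed.

Lemma size_reflected_poly_leq s : (size (reflected_poly s) <= (size s).+1)%N.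
Proof.
rewrite /reflected_poly; elim: s => [|a s IH].
  by rewrite big_nil size_polyC oner_eq0.
rewrite big_cons; apply: (leq_trans (size_polyMleq _ _)).
have sa : (size ((r%:C ^+ 2)%:P - a^* *: 'X)%R <= 2)%N.
  apply: (leq_trans (size_polyD _ _)); rewrite geq_max size_polyN.
  rewrite (leq_trans (size_polyC_leq1 _))//=.
  by rewrite (leq_trans (size_scale_leq _ _))// size_polyX.
by rewrite -subn1 leq_subLR (leq_trans (leq_add sa IH)).
Qed.

(** For [a] in the disc, the sign of the right-hand side depends only on the side of the circle on
    which [w] lies. This gives both bounds on the modulus of the Blaschke product, factor by
    factor. *)
Lemma sqr_norm_reflected a w :
  `|r%:C ^+ 2 - a^* * w| ^+ 2 - (r%:C * `|w - a|) ^+ 2 =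
  (r%:C ^+ 2 - `|w| ^+ 2) * (r%:C ^+ 2 - `|a| ^+ 2).
Proof.
rewrite exprMn !normCK !rmorphB/= conj_sqr_real rmorphM/= conjCK.
by ring.
Qed.

Lemma reflected_circle a w : `|w| = r%:C -> r%:C ^+ 2 - a^* * w = w * (w - a)^*.
Proof. by move=> <-; rewrite normCK rmorphB/= mulrBr [w * a^*]mulrC. Qed.

Lemma conj_inv_circle w : `|w| = r%:C -> r%:C ^+ 2 / w^* = w.
Proof.
move=> wr; rewrite -wr normCK mulfK// conjC_eq0 -normr_eq0 wr.
exact: rC_neq0.
Qed.

Lemma horner_reflected_circle s w : `|w| = r%:C ->
  (reflected_poly s).[w] = w ^+ size s * ((zero_poly s).[w])^*.
Proof.
move=> wr; rewrite horner_reflected_poly horner_zero_poly rmorph_prod/=.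
elim: s => [|a s IH]; first by rewrite !big_nil mulr1.
by rewrite !big_cons IH reflected_circle//= exprS mulrACA.
Qed.

Section InDisc.
Variable s : seq C.
Hypothesis sr : all (fun a => `|a| < r%:C) s.

Let memr a : a \in s -> `|a| < r%:C. Proof. by move/(allP sr). Qed.

Lemma zero_poly_neq0 w : r%:C <= `|w| -> (zero_poly s).[w] != 0.
Proof.
move=> rw; rewrite horner_zero_poly prodf_seq_neq0; apply/allP => a /memr ar.
rewrite subr_eq0; apply: contraTneq rw => ->.
by rewrite real_leNgt ?negbK// ?normr_real// realE ltW.
Qed.

Lemma reflected_poly_neq0 w : `|w| <= r%:C -> (reflected_poly s).[w] != 0.
Proof.
move=> wr; rewrite horner_reflected_poly prodf_seq_neq0; apply/allP => a /memr ar.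
rewrite implyTb subr_eq0; apply/eqP => /(congr1 Num.norm)/eqP.
rewrite [X in X == _]normrX [X in _ == X]normrM norm_conjC ger0_norm 1?ltW// expr2.
rewrite gt_eqF//; have [->|w0] := eqVneq w 0; first by rewrite normr0 mulr0 mulr_gt0.
apply: (@lt_le_trans _ _ (r%:C * `|w|)); first by rewrite ltr_pM2r ?normr_gt0.
by rewrite ler_pM2l.
Qed.

Lemma norm_blaschke_le w : `|w| <= r%:C ->
  r%:C ^+ size s * `|(zero_poly s).[w]| <= `|(reflected_poly s).[w]|.
Proof.
move=> wr; rewrite horner_zero_poly horner_reflected_poly !normr_prod.
rewrite -prodr_const_seq -big_split/= !big_seq.
apply: ler_prod => a /memr ar; rewrite mulr_ge0 ?(ltW rC_gt0)//=.
rewrite -(@ler_pXn2r _ 2)// ?nnegrE ?mulr_ge0 ?(ltW rC_gt0)//.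
rewrite -subr_ge0 sqr_norm_reflected mulr_ge0// subr_ge0 lerXn2r ?nnegrE ?(ltW rC_gt0)//.
exact: ltW.
Qed.

Lemma norm_blaschke_ge w : r%:C <= `|w| ->
  `|(reflected_poly s).[w]| <= r%:C ^+ size s * `|(zero_poly s).[w]|.
Proof.
move=> wr; rewrite horner_zero_poly horner_reflected_poly !normr_prod.
rewrite -prodr_const_seq -big_split/= !big_seq.
apply: ler_prod => a /memr ar; rewrite normr_ge0/=.
rewrite -(@ler_pXn2r _ 2)// ?nnegrE ?mulr_ge0 ?(ltW rC_gt0)//.
rewrite -subr_le0 sqr_norm_reflected mulr_le0_ge0//.
  by rewrite subr_le0 lerXn2r ?nnegrE ?(ltW rC_gt0).
by rewrite subr_ge0 lerXn2r ?nnegrE ?(ltW rC_gt0)// ltW.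
Qed.

Variable rho : C.
Hypothesis rho_r : `|rho| = r%:C.
Local Notation E := (node_poly s rho).

Let rho0 : rho != 0. Proof. by rewrite -normr_eq0 rho_r. Qed.

Lemma horner_node_poly w : E.[w] =
  r%:C ^+ size s * (w * (zero_poly s).[w]) - rho * (reflected_poly s).[w].
Proof. by rewrite /node_poly !hornerE. Qed.

Lemma root_node_polyE w : root E w ->
  rho * (reflected_poly s).[w] = r%:C ^+ size s * (w * (zero_poly s).[w]).
Proof. by move=> /rootP; rewrite horner_node_poly => /eqP; rewrite subr_eq0 => /eqP. Qed.

(** Inside the circle [|B| <= 1] and [|w| < r], outside both inequalities are reversed, so
    [|w B(w)| = r] fails off the circle. Strictness comes from the factor [w], so [s] may be
    empty. *)
Lemma root_node_poly_circle w : root E w -> `|w| = r%:C.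
Proof.
move/root_node_polyE/(congr1 Num.norm); rewrite !normrM rho_r normrX.
rewrite (ger0_norm (ltW rC_gt0)).
rewrite mulrCA => e.
have [||//] := real_ltgtP (normr_real w) rC_real.
- move=> wr; move: e => /eqP; rewrite gt_eqF//.
  apply: (@le_lt_trans _ _ (`|w| * `|(reflected_poly s).[w]|)).
    by rewrite ler_wpM2l// norm_blaschke_le// ltW.
  by rewrite ltr_pM2r// normr_gt0 reflected_poly_neq0// ltW.
- move=> wr; move: e => /eqP; rewrite lt_eqF//.
  apply: (@le_lt_trans _ _ (r%:C * (r%:C ^+ size s * `|(zero_poly s).[w]|))).
    by rewrite ler_pM2l// norm_blaschke_ge// ltW.
  by rewrite ltr_pM2r// mulr_gt0 ?exprn_gt0// normr_gt0 zero_poly_neq0// ltW.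
Qed.

Lemma size_node_poly : size E = (size s).+2.
Proof.
have sX : size (r%:C ^+ size s *: ('X * zero_poly s)) = (size s).+2.
  rewrite size_scale ?expf_neq0// mulrC size_mulX ?size_zero_poly//.
  by rewrite -size_poly_eq0 size_zero_poly.
rewrite /node_poly size_polyDl ?sX// size_polyN size_scale//.
by rewrite ltnS size_reflected_poly_leq.
Qed.

Lemma poisson_sum_ge0 w : 0 <= poisson_sum s w.
Proof.
rewrite /poisson_sum big_seq; apply: sumr_ge0 => a /memr ar.
by rewrite divr_ge0 ?exprn_ge0// subr_ge0 lerXn2r ?nnegrE ?(ltW rC_gt0)// ltW.
Qed.

Lemma poisson_sum1_neq0 w : 1 + poisson_sum s w != 0.
Proof. by apply: lt0r_neq0; apply: ltr_wpDr => //; exact: poisson_sum_ge0. Qed.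

(* On the circle this is [z B'(z) / B(z) = poisson_sum s z] for the Blaschke
   product [B]. *)
Lemma deriv_node_poly w : root E w ->
  E^`().[w] = r%:C ^+ size s * (zero_poly s).[w] * (1 + poisson_sum s w).
Proof.
move=> Ew; have wr := root_node_poly_circle Ew.
have eE := root_node_polyE Ew.
have w0 : w != 0 by rewrite -normr_eq0 wr.
have z0 a : a \in s -> w - a != 0.
  move=> /memr; rewrite subr_eq0; apply: contraTneq => <-.
  by rewrite wr ltxx.
have rf0 a : a \in s -> r%:C ^+ 2 - a^* * w != 0.
  by move=> sa; rewrite reflected_circle// mulf_neq0// conjC_eq0 z0.
have d1 : (zero_poly s)^`().[w] = (zero_poly s).[w] * \sum_(a <- s) (w - a)^-1.
  rewrite horner_deriv_prod => [|a sa]; last by rewrite hornerXsubC z0.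
  by congr (_ * _); apply: eq_bigr => a _; rewrite derivXsubC !hornerE ?mul1r.
have d2 : (reflected_poly s)^`().[w] =
    (reflected_poly s).[w] * \sum_(a <- s) - a^* / (r%:C ^+ 2 - a^* * w).
  rewrite horner_deriv_prod => [|a sa]; last by rewrite !hornerE rf0.
  by congr (_ * _); apply: eq_bigr => a _;
    rewrite derivB derivC derivZ derivX !hornerE ?(sub0r, mulr1).
(* On the circle [r ^ 2 - a^* w] equals [w] times the conjugate of [w - a], which makes each term of
   the difference of logarithmic derivatives a Poisson kernel. *)
have -> : poisson_sum s w =
    w * (\sum_(a <- s) (w - a)^-1 - \sum_(a <- s) - a^* / (r%:C ^+ 2 - a^* * w)).
  rewrite -sumrB mulr_sumr /poisson_sum !big_seq; apply: eq_bigr => a sa.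
  rewrite reflected_circle// -wr !normCK.
  have := z0 a sa; have : (w - a)^* != 0 by rewrite conjC_eq0 z0.
  rewrite rmorphB/= => b0 a0.
  by field; rewrite w0 a0 b0.
rewrite /node_poly derivB !derivZ derivM derivX !hornerE d1 d2 [rho * (_ * _)]mulrA eE.
by ring.
Qed.

Lemma node_poly_roots : exists rs : seq C,
  [/\ uniq rs, size rs = (size s).+1 & forall w, root E w = (w \in rs)].
Proof.
have [rs Ers] := closed_field_poly_normal E.
have lc0 : lead_coef E != 0 by rewrite lead_coef_eq0 -size_poly_eq0 size_node_poly.
have rE w : root E w = (w \in rs) by rewrite Ers rootZ// root_prod_XsubC.
exists rs; split => //; last first.
  have := size_node_poly; rewrite Ers size_scale// size_prod_XsubC.
  by case.
(* A repeated root would annihilate the derivative, but [deriv_node_poly] is a product of nonzero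
   factors, as [poisson_sum] is nonnegative. *)
apply/negPn/negP => nu.
have [w wc] : exists w, (1 < count_mem w rs)%N.
  apply/not_existsP => H; move/negP: nu; apply.
  apply/count_mem_uniq => w; apply/eqP; rewrite eqn_leq.
  case: (boolP (w \in rs)) => [win|/count_memPn -> //].
  by rewrite -has_count has_pred1 win andbT leqNgt; apply/negP/H.
have rw : root E w by rewrite rE -has_pred1 has_count (ltn_trans _ wc).
have : ('X - w%:P) ^+ 2 %| E.
  by rewrite Ers dvdpZr// -mup_geq ?mu_prod_XsubC// monic_neq0// monic_prod_XsubC.
move=> /dvdpP[q qE].
have : E^`().[w] = 0.
  rewrite qE expr2 !derivM !(hornerXsubC, hornerM, hornerD).
  by rewrite subrr !(mulr0, mul0r, addr0).
rewrite deriv_node_poly// => /eqP; apply/negP.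
have wr := root_node_poly_circle rw.
by rewrite !mulf_neq0 ?expf_neq0 ?poisson_sum1_neq0// zero_poly_neq0// wr.
Qed.

Lemma root_node_poly_blaschke w : root E w =
  (w * \prod_(a <- s) (r%:C * ((w - a) / (r%:C ^+ 2 - w * a^*))) == rho).
Proof.
rewrite big_split/= prodr_const_seq big_split/= prodfV -horner_zero_poly.
have -> : \prod_(a <- s) (r%:C ^+ 2 - w * a^*) = (reflected_poly s).[w].
  by rewrite horner_reflected_poly; apply: eq_bigr => a _; rewrite [w * _]mulrC.
rewrite rootE horner_node_poly subr_eq0.
(* At a pole of the Blaschke product the formal quotient is 0, hence not [rho]. The polynomial does
   not vanish there either: such a [w] lies outside the circle, where [zero_poly s] has no zero. *)
have [d0|d0] := eqVneq (reflected_poly s).[w] 0.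
  rewrite d0 invr0 !mulr0 [0 == rho]eq_sym (negPf rho0); apply/negbTE.
  have wr : r%:C < `|w|.
    rewrite real_ltNge ?normr_real ?realE ?(ltW rC_gt0)//.
    by apply/negP => /reflected_poly_neq0; rewrite d0 eqxx.
  rewrite !mulf_neq0 ?expf_neq0 ?zero_poly_neq0 ?(ltW wr)//.
  by rewrite -normr_gt0 (lt_trans rC_gt0 wr).
rewrite -[RHS](inj_eq (mulIf d0)) mulrCA !mulrA divfK//.
by congr (_ == _); rewrite -[LHS]mulrA mulrC.
Qed.

End InDisc.

(** The zeros of the first polynomial lie inside the circle, those of the second outside. *)
Lemma coprimep_zero_reflected s t :
  all (fun a => `|a| < r%:C) s -> all (fun a => `|a| < r%:C) t ->
  coprimep (zero_poly s) (reflected_poly t).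
Proof.
move=> sr tr; apply/Pdiv.ClosedField.coprimepP => w /rootP z0; apply/negP => /rootP e0.
have [|] := real_leP (normr_real w) rC_real.
  by move/(reflected_poly_neq0 tr); rewrite e0 eqxx.
by move/ltW/(zero_poly_neq0 sr); rewrite z0 eqxx.
Qed.
End Nodes.

(** * The quadrature formula *)

Section Quadrature.
Local Open Scope ring_scope.
Variables (R : realType) (r : R).
Hypothesis r0 : 0 < r.
Local Notation C := R[i].
Implicit Types (s : seq C) (p : {poly C}).

Let rC_gt0 : 0 < r%:C. Proof. by rewrite (ltcR 0). Qed.
Let rC_neq0 : r%:C != 0. Proof. by rewrite gt_eqF. Qed.

(* The polynomial [w |-> w ^ n * (p (r ^ 2 / w^* ))^*], for [p] of degree at
   most [n]. *)
Definition reciprocal_poly n p : {poly C} :=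
  \poly_(i < n.+1) ((p`_(n - i))^* * (r%:C ^+ 2) ^+ (n - i)).

Lemma horner_reciprocal_poly n p w : (size p <= n.+1)%N -> w != 0 ->
  (reciprocal_poly n p).[w] = w ^+ n * (p.[r%:C ^+ 2 / w^*])^*.
Proof.
move=> sp w0; rewrite horner_poly (horner_coef_wide _ sp) rmorph_sum/= mulr_sumr.
rewrite (reindex_inj rev_ord_inj); apply: eq_bigr => i _ /=.
have le_in : (i <= n)%N by rewrite -ltnS.
rewrite subSS subKn// rmorphM rmorphXn rmorphM fmorphV/= conj_sqr_real conjCK.
move: (r%:C ^+ 2) => c; rewrite -mulrA [RHS]mulrCA; congr (_ * _).
rewrite [(c / w) ^+ i]exprMn exprVn mulrCA (exprVE w0 le_in); congr (_ * _).
by rewrite mulrCA divff ?mulr1// expf_neq0.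
Qed.

Lemma horner_reciprocal_circle n p w : (size p <= n.+1)%N -> `|w| = r%:C ->
  (reciprocal_poly n p).[w] = w ^+ n * (p.[w])^*.
Proof.
move=> sp wr; rewrite horner_reciprocal_poly ?(conj_inv_circle r0)//.
by rewrite -normr_eq0 wr.
Qed.

Lemma reflect_poly_reciprocal n p : (size p <= n.+1)%N ->
  reflect_poly r p =
  FracField.tofrac (reciprocal_poly n p) / FracField.tofrac 'X^n.
Proof.
move=> sp; have [q -> qE] := reflect_polyE r sp.
(* [reflect_polyE] is used with exponent [n.+1], the bound on the size, so its numerator carries one
   more factor ['X] than the reciprocal polynomial of degree at most [n]. *)
have -> : q = 'X * reciprocal_poly n p.
  apply: eq_poly_neq0 => w w0.
  by rewrite hornerM hornerX horner_reciprocal_poly// mulrA -exprS qE.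
have X0 : FracField.tofrac 'X != 0 :> {fraction {poly C}}.
  by rewrite tofrac_eq0 polyX_eq0.
by rewrite exprS !tofracM -mulf_div divff// mul1r.
Qed.

(** The quotient is holomorphic outside the circle and vanishes at infinity. Conjugation on the
    circle turns it into a quotient by [reflected_poly r s] whose numerator vanishes at 0, to which
    [cint_prod_reflected] applies. *)
Lemma cint_vanishing_at_oo s p : all (fun a => `|a| < r%:C) s ->
  (size p <= size s)%N ->
  let g t := p.[r%:C * expi t] / (zero_poly s).[r%:C * expi t] in
  ccontinuous g /\ cint g = 0.
Proof.
move=> sr sp g.
have gc : ccontinuous g.
  have wc := @ccontinuous_circle R r.
  apply: ccontinuousM; first exact: ccontinuous_horner.
  apply: ccontinuousV; last exact: ccontinuous_horner.
  by move=> t; rewrite (zero_poly_neq0 r0 sr)// normr_circle.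
split => //.
(* For empty [s] the degree bound [(size s).-1] below would be off by one; here [p = 0]. *)
have [s0|s0] := posnP (size s).
  have p0 : p = 0 by apply/eqP; rewrite -size_poly_eq0 -leqn0 -s0.
  rewrite (@eq_cint _ g (fun=> 0)) ?cint_cst ?mulr0// => t.
  by rewrite /g p0 horner0 mul0r.
rewrite -[LHS]conjCK; have := cintJ gc => /= <-.
rewrite (@eq_cint _ _ (fun t => ('X * reciprocal_poly (size s).-1 p).[r%:C * expi t] /
    \prod_(a <- s) (r%:C ^+ 2 - a^* * (r%:C * expi t)))).
  have [_ _ ->] := cint_prod_reflected r0 ('X * reciprocal_poly (size s).-1 p) sr.
  by rewrite hornerM hornerX mul0r mulr0 mul0r conjC0.
move=> t; rewrite /g; set w := r%:C * expi t.
have wr : `|w| = r%:C by exact: normr_circle.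
have w0 : w != 0 by rewrite -normr_eq0 wr.
rewrite -horner_reflected_poly horner_reflected_circle// hornerM hornerX.
rewrite horner_reciprocal_circle ?prednK// mulrA -exprS prednK//.
by rewrite -mulf_div divff ?expf_neq0// mul1r rmorphM fmorphV.
Qed.

(* By Bezout, [T / (D * Ds)] splits as [U / D + V / Ds], where [D] has its zeros
   inside and [Ds] outside the circle; both the mean and the quadrature sum kill
   the first summand and send the second one to its value at 0. *)
Lemma blaschke_quadrature s N (rho : C) (T : {poly C}) (zeta : 'I_N.+1 -> C) :
  all (fun a => `|a| < r%:C) s -> size s = N -> `|rho| = r%:C ->
  injective zeta -> (forall k, root (node_poly r s rho) (zeta k)) ->
  (size T <= (2 * N).+1)%N ->
  cint (fun t => T.[r%:C * expi t] /
      ((zero_poly s).[r%:C * expi t] * (reflected_poly r s).[r%:C * expi t])) =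
  (2 * pi)%:C * \sum_k T.[zeta k] /
      ((zero_poly s).[zeta k] * (reflected_poly r s).[zeta k]) /
      (poisson_sum r s (zeta k) + 1).
Proof.
move=> sr sN rho_r zinj zroot sT.
set D := zero_poly s; set Ds := reflected_poly r s; set E := node_poly r s rho.
have D0 : D != 0 by rewrite -size_poly_eq0 size_zero_poly.
have [[u v] /= uv] := Bezout_eq1_coprimepP _ _ (coprimep_zero_reflected r0 sr sr).
rewrite -/D -/Ds in uv.
(* From [u D + v Ds = 1], [T] is [T u D + T v Ds]. Reducing [T v] modulo [D] bounds the degree of
   [U], and the quotient is moved into [V]. *)
pose U := (T * v) %% D; pose V := T * u + (T * v) %/ D * Ds.
have TE : T = U * Ds + V * D.
  rewrite /V mulrDl addrC -!mulrA [Ds * D]mulrC -addrA [_ * (D * Ds)]mulrA -mulrDl.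
  by rewrite -divp_eq -mulrA -mulrDr uv mulr1.
have sU : (size U <= N)%N by rewrite -ltnS -sN -(size_zero_poly s) ltn_modp.
(* The degree of [V] is read off from [V D = T - U Ds], not from its definition. *)
have sV : (size V <= N.+1)%N.
  have sVD : (size (V * D)%R <= (2 * N).+1)%N.
    have -> : V * D = T - U * Ds by rewrite TE addrC addKr.
    apply: (leq_trans (size_polyD _ _)); rewrite geq_max sT size_polyN.
    apply: (leq_trans (size_polyMleq _ _)); rewrite -subn1 leq_subLR.
    apply: (leq_trans (leq_add sU (size_reflected_poly_leq r s))).
    by rewrite sN mul2n -addnn addnS !add1n !ltnS.
  have [->|V0] := eqVneq V 0; first by rewrite size_poly0.
  move: sVD; rewrite size_mul// size_zero_poly sN addnS/= mul2n -addnn -addSn.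
  by rewrite leq_add2r.
have zr k : `|zeta k| = r%:C by exact: (root_node_poly_circle r0 sr rho_r).
have split w : `|w| = r%:C ->
    T.[w] / (D.[w] * Ds.[w]) = U.[w] / D.[w] + V.[w] / Ds.[w].
  move=> wr; have d0 : D.[w] != 0 by rewrite (zero_poly_neq0 r0 sr)// wr.
  have ds0 : Ds.[w] != 0 by rewrite (reflected_poly_neq0 r0 sr)// wr.
  by rewrite {1}TE hornerD !hornerM; field; rewrite d0 ds0.
have [c1 i1] := cint_vanishing_at_oo sr (leq_trans sU (eq_leq (esym sN))).
have [c2 _ i2] := cint_prod_reflected r0 V sr.
have -> : cint (fun t => T.[r%:C * expi t] /
      (D.[r%:C * expi t] * Ds.[r%:C * expi t])) = (2 * pi)%:C * V.[0] / Ds.[0].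
  have Ds0 : Ds.[0] = r%:C ^+ (2 * size s).
    rewrite horner_reflected_poly exprM -prodr_const_seq.
    by apply: eq_bigr => a _; rewrite mulr0 subr0.
  rewrite Ds0 -i2 -[RHS]add0r -i1 -cintD//; apply: eq_cint => t.
  by rewrite split ?normr_circle// -horner_reflected_poly.
rewrite -mulrA; congr (_ * _).
(* The [N + 1] distinct nodes exhaust the roots of [E]. The interpolation sums concern the monic
   [P], hence the factors [c] below. *)
have Ef : E = lead_coef E *: \prod_k ('X - (zeta k)%:P).
  have -> : \prod_k ('X - (zeta k)%:P) = \prod_(x <- codom zeta) ('X - x%:P).
    by rewrite big_map big_enum.
  apply: all_roots_prod_XsubC.
  - by rewrite size_codom card_ord size_node_poly// sN.
  - by apply/allP => _ /codomP[k ->]; exact: zroot.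
  - by rewrite uniq_rootsE map_inj_uniq ?enum_uniq.
set P := \prod_k _ in Ef; set c := lead_coef E in Ef.
have c0 : c != 0 by rewrite lead_coef_eq0 -size_poly_eq0 size_node_poly.
have E' x : P^`().[x] = E^`().[x] / c.
  by rewrite Ef derivZ hornerZ mulrC mulKf.
have E0 : P.[0] = - rho * Ds.[0] / c.
  have : E.[0] = - rho * Ds.[0] by rewrite horner_node_poly mul0r mulr0 sub0r mulNr.
  by move=> <-; rewrite [in RHS]Ef hornerZ mulrC mulKf.
have z0 k : zeta k != 0 by rewrite -normr_eq0 zr.
have rho0 : rho != 0 by rewrite -normr_eq0 rho_r.
have ds00 : Ds.[0] != 0 by rewrite (reflected_poly_neq0 r0 sr)// normr0 ltW.
have sumU : \sum_k U.[zeta k] / P^`().[zeta k] = 0.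
  by apply: (sum_div_deriv_eq0 zinj); rewrite card_ord ltnS.
have sumV : \sum_k V.[zeta k] / (zeta k * P^`().[zeta k]) = - (V.[0] / P.[0]).
  by apply: (sum_div_deriv zinj) => //; rewrite card_ord.
have term k :
    T.[zeta k] / (D.[zeta k] * Ds.[zeta k]) / (poisson_sum r s (zeta k) + 1) =
    r%:C ^+ size s / c * (U.[zeta k] / P^`().[zeta k]) +
    rho / c * (V.[zeta k] / (zeta k * P^`().[zeta k])).
  rewrite split// !E' (deriv_node_poly r0 sr rho_r (zroot k)) -/D.
  have := root_node_polyE (zroot k); rewrite -/D -/Ds => e.
  have := poisson_sum1_neq0 r0 sr (zeta k).
  set m := poisson_sum _ _ _ => m0.
  have d0 : D.[zeta k] != 0 by rewrite (zero_poly_neq0 r0 sr)// zr.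
  have ds0 : Ds.[zeta k] != 0 by rewrite (reflected_poly_neq0 r0 sr)// zr.
  have -> : Ds.[zeta k] = r%:C ^+ size s * (zeta k * D.[zeta k]) / rho.
    by rewrite -e mulrC mulKf.
  have rs0 : r%:C ^+ size s != 0 by rewrite expf_neq0.
  move: rs0; set x := r%:C ^+ _ => rs0.
  by field; rewrite rho0 d0 m0 c0 rs0 z0.
rewrite (eq_bigr _ (fun k _ => term k)) big_split/= -!mulr_sumr.
rewrite sumU sumV E0 mulr0 add0r.
by field; rewrite c0 rho0 ds00.
Qed.

End Quadrature.

(** * Rational functions on the circle *)

Section Repetition.
Local Open Scope ring_scope.
Variables (T : eqType) (nu : nat) (z : 'I_nu -> T).
Implicit Types nk : 'I_nu -> nat.

(** Multiplicities become repetitions in a list, so that the sections above need only linear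
    factors. *)
Definition repeat_seq nk : seq T := flatten [seq nseq (nk k) (z k) | k <- enum 'I_nu].

Lemma size_repeat_seq nk : size (repeat_seq nk) = (\sum_k nk k)%N.
Proof.
rewrite size_flatten /shape -map_comp sumnE big_map big_enum.
by apply: eq_bigr => k _; rewrite /= size_nseq.
Qed.

Lemma mem_repeat_seq nk a : a \in repeat_seq nk -> exists k, a = z k.
Proof.
by move=> /flattenP[_ /mapP[k _ ->]] /nseqP[-> _]; exists k.
Qed.

Lemma count_repeat_seq nk k : injective z ->
  count_mem (z k) (repeat_seq nk) = nk k.
Proof.
move=> zi; rewrite count_flatten -map_comp sumnE big_map big_enum.
rewrite (bigD1 k)//= count_nseq /= eqxx mul1n big1 ?addn0// => j jk.
by rewrite count_nseq /= (inj_eq zi) (negPf jk).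
Qed.

Lemma prod_repeat_seq (A : comPzRingType) nk (f : T -> A) :
  \prod_(a <- repeat_seq nk) f a = \prod_k f (z k) ^+ nk k.
Proof.
rewrite big_flatten big_map big_enum; apply: eq_bigr => k _ /=.
by rewrite big_nseq iter_mulr_1.
Qed.

Lemma sum_repeat_seq (A : zmodType) nk (f : T -> A) :
  \sum_(a <- repeat_seq nk) f a = \sum_k f (z k) *+ nk k.
Proof.
rewrite big_flatten big_map big_enum; apply: eq_bigr => k _ /=.
by rewrite big_nseq iter_addr_0.
Qed.

End Repetition.

(** * Factoring the denominator and clearing it on the circle *)

Section RationalFunction.
Local Open Scope ring_scope.
Variables (R : realType) (r : R).
Hypothesis r0 : 0 < r.
Local Notation C := R[i].
Implicit Types (s : seq C) (p : {poly C}).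

Let rC_gt0 : 0 < r%:C. Proof. by rewrite (ltcR 0). Qed.
Let rC_neq0 : r%:C != 0. Proof. by rewrite gt_eqF. Qed.
Let rC_real : r%:C \is Num.real. Proof. by rewrite realE ltW. Qed.

Definition into_disc (a : C) : C := if `|a| < r%:C then a else r%:C ^+ 2 / a^*.

Lemma norm_into_disc a : `|a| != r%:C -> `|into_disc a| < r%:C.
Proof.
rewrite /into_disc; case: ifPn => // nar ar.
have ra : r%:C < `|a|.
  by rewrite lt_neqAle eq_sym ar real_leNgt// normr_real.
have a0 : 0 < `|a| by apply: lt_trans ra.
rewrite normrM normfV norm_conjC normrX (ger0_norm (ltW rC_gt0)).
by rewrite ltr_pdivrMr// expr2 ltr_pM2l.
Qed.

(** Reflecting [a] in the circle exchanges the two linear factors up to constants. The constant is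
    [|a| ^ 2 / r ^ 2] when [a] is moved, 1 otherwise. *)
Lemma into_disc_factor a : exists2 c, c != 0 &
  ('X - a%:P) * ((r%:C ^+ 2)%:P - a^* *: 'X) =
  c *: (('X - (into_disc a)%:P) * ((r%:C ^+ 2)%:P - (into_disc a)^* *: 'X)).
Proof.
rewrite /into_disc; case: ifPn => [_|nar].
  by exists 1; rewrite ?oner_neq0// scale1r.
have a0 : a != 0 by apply: contraNneq nar => ->; rewrite normr0.
have a'0 : a^* != 0 by rewrite conjC_eq0.
exists (a * a^* / r%:C ^+ 2); first by rewrite !mulf_neq0 ?invr_eq0 ?expf_neq0.
have -> : (r%:C ^+ 2 / a^*)^* = r%:C ^+ 2 / a.
  by rewrite rmorphM fmorphV/= conj_sqr_real conjCK.
have : r%:C ^+ 2 != 0 by rewrite expf_neq0.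
move: (r%:C ^+ 2) (a^*) a'0 => c b b0 c0.
apply: eq_poly_neq0 => w _.
rewrite !(hornerXsubC, hornerZ, hornerM, hornerD, hornerN, hornerC, hornerX).
by field; rewrite a0 b0 c0.
Qed.

(* The zeros of [p] and of its reciprocal polynomial are exchanged by the
   reflection in the circle, so that half of the zeros of their product lie in
   the disc. *)
Lemma mul_reciprocal_poly n p : p != 0 -> (size p <= n.+1)%N ->
  (forall a, `|a| = r%:C -> ~~ root p a) ->
  exists t : seq C, [/\ size t = n, all (fun a => `|a| < r%:C) t &
    exists2 c, c != 0 &
      p * reciprocal_poly r n p = c *: (zero_poly t * reflected_poly r t)].
Proof.
move=> p0 sp pr; have [u pE] := closed_field_poly_normal p.
have lc0 : lead_coef p != 0 by rewrite lead_coef_eq0.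
have su : (size u <= n)%N by move: sp; rewrite pE size_scale// size_prod_XsubC.
have ur a : a \in u -> `|a| != r%:C.
  move=> au; apply/eqP => /pr; rewrite pE rootZ// root_prod_XsubC.
  by rewrite au.
(* If the degree of [p] is below [n], the missing zeros sit at infinity and are reflected to the
   origin, which gives the power of ['X]. *)
have recE : reciprocal_poly r n p =
    (lead_coef p)^* *: ('X^(n - size u) * reflected_poly r u).
  apply: eq_poly_neq0 => w w0; rewrite horner_reciprocal_poly// {1}pE.
  rewrite !hornerZ hornerM hornerXn rmorphM/= mulrCA; congr (_ * _).
  rewrite -[in LHS](subnK su) exprD -mulrA; congr (_ * _).
  rewrite -/(zero_poly u) horner_zero_poly horner_reflected_poly rmorph_prod/=.
  rewrite -prodr_const_seq -big_split/=; apply: eq_bigr => a _.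
  rewrite rmorphB rmorphM/= fmorphV/= conj_sqr_real conjCK.
  by rewrite mulrBr mulrCA mulfV// mulr1 [w * _]mulrC.
have [c c0 cE] : exists2 c, c != 0 & zero_poly u * reflected_poly r u =
    c *: (zero_poly (map into_disc u) * reflected_poly r (map into_disc u)).
  rewrite /zero_poly /reflected_poly !big_map.
  elim: u {pE su ur recE} => [|a u [c c0 IH]].
    by exists 1; rewrite ?oner_neq0// !big_nil mulr1 scale1r.
  have [d d0 dE] := into_disc_factor a.
  exists (d * c); first by rewrite mulf_neq0.
  by rewrite !big_cons mulrACA dE IH -scalerAl -scalerAr scalerA mulrACA.
(* The zeros at the origin pad the list to length [n]; each contributes a constant [r ^ 2] to
   [reflected_poly], which the scalar divides out. *)
exists (map into_disc u ++ nseq (n - size u) 0); split.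
- by rewrite size_cat size_map size_nseq subnKC.
- rewrite all_cat; apply/andP; split.
    by apply/allP => _ /mapP[a au ->]; exact/norm_into_disc/ur.
  by apply/allP => _ /nseqP[-> _]; rewrite normr0.
- exists (lead_coef p * (lead_coef p)^* * c / (r%:C ^+ 2) ^+ (n - size u)).
    by rewrite !mulf_neq0 ?conjC_eq0 ?invr_eq0 ?expf_neq0.
  rewrite recE {1}pE -/(zero_poly u) -scalerAl -scalerAr mulrCA cE.
  rewrite /zero_poly /reflected_poly !big_cat/= !big_nseq !iter_mulr_1.
  rewrite subr0 conjC0 scale0r subr0 -polyC_exp.
  set A := \prod_(_ <- _) _; set B := \prod_(_ <- _) _.
  have : (r%:C ^+ 2) ^+ (n - size u) != 0 by rewrite !expf_neq0.
  move: (_ ^+ _) => d d0.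
  have -> : A * 'X^(n - size u) * (B * d%:P) = d *: ('X^(n - size u) * (A * B)).
    by rewrite -mul_polyC; ring.
  by rewrite !scalerA divfK// -scalerAr scalerA.
Qed.

Variables (F : {fraction {poly C}}) (n : nat).
Hypothesis F_deg : rf_degree F = n.
Hypothesis F_circle : forall a : C, `|a| = r%:C -> pole_order F a = 0%N.

Lemma sum_pole_order :
  (\sum_(a \in [set: C]) pole_order F a)%N = (size (rf_den F)).-1.
Proof.
have [u dE] := closed_field_poly_normal (rf_den F).
have d0 := rf_den_neq0 F.
have po a : pole_order F a = count_mem a u.
  rewrite /pole_order dE -mul_polyC mupMr ?mu_prod_XsubC//.
  by rewrite rootC lead_coef_eq0.
rewrite dE size_scale ?lead_coef_eq0// size_prod_XsubC/=.
rewrite (@fsbigE _ _ _ _ _ (undup u)) ?undup_uniq//.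
  rewrite -sum1_size -[RHS]big_undup_iterop_count/=.
  apply: eq_big => [a|a _]; first by rewrite in_setT.
  rewrite po.
  by case: (count_mem a u) => // k; rewrite iteropS; elim: k => //= k <-.
move=> a _; rewrite mem_undup po; exact: count_memPn.
Qed.

(** The degree of [F] is the larger of the degrees of its numerator and denominator, thanks to the
    truncated subtraction in [pole_order_oo]. *)
Lemma size_rf_le : (size (rf_num F) <= n.+1)%N /\ (size (rf_den F) <= n.+1)%N.
Proof.
have := F_deg; rewrite /rf_degree sum_pole_order /pole_order_oo.
have := rf_den_neq0 F; rewrite -size_poly_gt0.
move: (size _) (size _) => a b; lia.
Qed.

Lemma rf_den_circle w : `|w| = r%:C -> ~~ root (rf_den F) w.
Proof.
move=> /F_circle; rewrite /pole_order => m0; apply/negP.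
by rewrite -dvdp_XsubCl XsubC_dvd ?rf_den_neq0// m0.
Qed.

(** Using the same [n] for both reciprocals makes the powers of ['X] cancel. The resulting fraction
    need not be reduced. *)
Lemma calR_reciprocal : calR r F =
  FracField.tofrac (rf_num F * reciprocal_poly r n (rf_num F)) /
  FracField.tofrac (rf_den F * reciprocal_poly r n (rf_den F)).
Proof.
have [sp sq] := size_rf_le.
have XN0 : FracField.tofrac 'X^n != 0 :> {fraction {poly C}}.
  by rewrite tofrac_eq0 expf_neq0// polyX_eq0.
rewrite /calR /Defs.reflect (reflect_poly_reciprocal r sp).
rewrite (reflect_poly_reciprocal r sq).
rewrite [X in X * _](frac_rfE F).
rewrite !tofracM -[RHS]mulf_div; congr (_ * _).
by rewrite invfM invrK mulrACA (mulVf XN0) mulr1.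
Qed.

Variables (nu : nat) (z : 'I_nu -> C) (nk : 'I_nu -> nat).
Hypothesis z_inj : injective z.
Hypothesis z_disc : forall k, `|z k| < r%:C.
Hypothesis nkE : forall k, nk k = pole_order (calR r F) (z k).
Hypothesis sum_nk : (\sum_(k < nu) nk k)%N = n.
Local Notation s := (repeat_seq z nk).

(* Since the [n_k] add up to [n], the poles of [calR r F] in the disc are all
   the zeros there of [q * reciprocal_poly r n q], for [q = rf_den F]. *)
Lemma rf_den_factor : exists2 c, c != 0 &
  rf_den F * reciprocal_poly r n (rf_den F) =
  c *: (zero_poly s * reflected_poly r s).
Proof.
have [sp sq] := size_rf_le.
have [t [st tr [c c0 E]]] := mul_reciprocal_poly (rf_den_neq0 F) sq rf_den_circle.
exists c => //.
have D0 : rf_den F * reciprocal_poly r n (rf_den F) != 0.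
  rewrite E scaler_eq0 negb_or c0 mulf_neq0//.
    by rewrite -size_poly_eq0 size_zero_poly.
  apply/negP => /eqP e0; have := reflected_poly_neq0 r0 tr (w := 0).
  by rewrite normr0 ltW// e0 horner0 eqxx => /(_ isT).
have den_dvd : rf_den (calR r F) %| rf_den F * reciprocal_poly r n (rf_den F).
  have := rf_cross (rf_num F * reciprocal_poly r n (rf_num F)) D0.
  rewrite -calR_reciprocal => e.
  rewrite -(@Gauss_dvdpr _ _ (rf_num (calR r F))).
    by rewrite -e dvdp_mull.
  by rewrite coprimep_sym rf_coprime.
suff st_perm : perm_eq s t.
  by rewrite E /zero_poly /reflected_poly !(perm_big _ st_perm).
(* The order of a pole is at most its multiplicity in the unreduced denominator, which inside the
   disc is counted by [t] alone. So [s] is a sub-multiset of [t], and both have size [n]. *)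
have le_count a : (count_mem a s <= count_mem a t)%N.
  have [/mem_repeat_seq[k ->]|/count_memPn->//] := boolP (a \in s).
  rewrite count_repeat_seq// nkE /pole_order -mu_prod_XsubC.
  have -> : mup (z k) (\prod_(y <- t) ('X - y%:P)) =
      mup (z k) (rf_den F * reciprocal_poly r n (rf_den F)).
    rewrite E -mul_polyC mupMr ?rootC// mupMl//.
    by apply/negP => /rootP; apply/eqP; rewrite (reflected_poly_neq0 r0 tr)// ltW.
  rewrite mup_geq//; apply: dvdp_trans den_dvd.
  by rewrite -mup_geq ?rf_den_neq0.
have /count_subseqP[t' sub_t' st'] := le_count.
suff <- : t' = t by [].
apply/eqP; rewrite -(size_subseq_leqif sub_t') -(perm_size st').
by rewrite size_repeat_seq sum_nk st.
Qed.

(** Multiply numerator and denominator by the reciprocal of the denominator, which has no zero on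
    the circle. *)
Lemma rf_eval_circle : exists2 T : {poly C}, (size T <= (2 * n).+1)%N &
  forall w, `|w| = r%:C ->
    rf_eval F w = T.[w] / ((zero_poly s).[w] * (reflected_poly r s).[w]).
Proof.
have [sp sq] := size_rf_le; have [c c0 E] := rf_den_factor.
exists (c^-1 *: (rf_num F * reciprocal_poly r n (rf_den F))) => [|w wr].
  apply: (leq_trans (size_scale_leq _ _)); apply: (leq_trans (size_polyMleq _ _)).
  rewrite -subn1 leq_subLR; apply: (leq_trans (leq_add sp (size_poly _ _))).
  by rewrite mul2n -addnn addnS.
have w0 : w != 0 by rewrite -normr_eq0 wr.
have q0 := rf_den_circle wr; rewrite rootE in q0.
have rq0 : (reciprocal_poly r n (rf_den F)).[w] != 0.
  by rewrite horner_reciprocal_circle// mulf_neq0 ?expf_neq0 ?conjC_eq0.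
have := congr1 (horner^~ w) E; rewrite hornerM hornerZ hornerM.
move/(canLR (mulKf c0)) => <-; rewrite /rf_eval hornerZ hornerM.
by field; rewrite c0 q0 rq0.
Qed.

(** On the circle a reciprocal polynomial is [w ^ n] times the conjugate value, and the two factors
    [w ^ n] cancel. *)
Lemma norm_rf_eval_circle : exists2 T : {poly C}, (size T <= (2 * n).+1)%N &
  forall w, `|w| = r%:C -> `|rf_eval F w| ^+ 2 =
    T.[w] / ((zero_poly s).[w] * (reflected_poly r s).[w]).
Proof.
have [sp sq] := size_rf_le; have [c c0 E] := rf_den_factor.
exists (c^-1 *: (rf_num F * reciprocal_poly r n (rf_num F))) => [|w wr].
  apply: (leq_trans (size_scale_leq _ _)); apply: (leq_trans (size_polyMleq _ _)).
  rewrite -subn1 leq_subLR; apply: (leq_trans (leq_add sp (size_poly _ _))).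
  by rewrite mul2n -addnn addnS.
have w0 : w != 0 by rewrite -normr_eq0 wr.
have q0 := rf_den_circle wr; rewrite rootE in q0.
have := congr1 (horner^~ w) E; rewrite hornerM hornerZ hornerM.
move/(canLR (mulKf c0)) => <-; rewrite /rf_eval hornerZ hornerM normCK.
rewrite !horner_reciprocal_circle// rmorphM fmorphV/=.
have q'0 : ((rf_den F).[w])^* != 0 by rewrite conjC_eq0.
have wn0 : w ^+ n != 0 by rewrite expf_neq0.
move: (_ ^+ _) wn0 => x x0.
by field; rewrite c0 q0 q'0 x0.
Qed.

End RationalFunction.

(** * Notches *)

Section Notches.
Local Open Scope ring_scope.
Variables (R : realType) (r : R).
Hypothesis r0 : 0 < r.
Local Notation C := R[i].
Variables (nu : nat) (z : 'I_nu -> C) (nk : 'I_nu -> nat) (n m : nat) (phi : R).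
Hypothesis z_disc : forall k, `|z k| < r%:C.
Hypothesis sum_nk : (\sum_(k < nu) nk k)%N = n.
Local Notation s := (repeat_seq z (fun k => m * nk k)%N).
Local Notation rho := (r%:C * expi phi).

Lemma zero_poly_repeat : zero_poly s = zero_poly (repeat_seq z nk) ^+ m.
Proof.
rewrite /zero_poly !prod_repeat_seq -prodrXl.
by apply: eq_bigr => k _; rewrite mulnC exprM.
Qed.

Lemma reflected_poly_repeat :
  reflected_poly r s = reflected_poly r (repeat_seq z nk) ^+ m.
Proof.
rewrite /reflected_poly !prod_repeat_seq -prodrXl.
by apply: eq_bigr => k _; rewrite mulnC exprM.
Qed.

Lemma poisson_sum_repeat w : poisson_sum r s w = m%:R * muB r z nk w.
Proof.
rewrite /poisson_sum sum_repeat_seq /muB mulr_sumr; apply: eq_bigr => k _.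
by rewrite -[LHS]mulr_natl natrM !mulrA.
Qed.

Lemma blaschke_repeat w :
  \prod_(a <- s) (r%:C * ((w - a) / (r%:C ^+ 2 - w * a^*))) =
  blaschke r z nk w ^+ m.
Proof.
rewrite prod_repeat_seq /blaschke -prodrXl; apply: eq_bigr => k _.
by rewrite mulnC exprM.
Qed.

Let sr : all (fun a => `|a| < r%:C) s.
Proof. by apply/allP => a /mem_repeat_seq[k ->]. Qed.

Let ss : size s = (m * n)%N.
Proof. by rewrite size_repeat_seq -big_distrr/= sum_nk. Qed.

Let rho_r : `|rho| = r%:C. Proof. exact: normr_circle. Qed.

Lemma root_notch w :
  w * blaschke r z nk w ^+ m = rho <-> root (node_poly r s rho) w.
Proof.
rewrite (root_node_poly_blaschke r0 sr rho_r) blaschke_repeat.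
by split => /eqP.
Qed.

Lemma exists_notches :
  exists zeta : 'I_(m * n).+1 -> C, notches r z nk m phi zeta.
Proof.
have [rs [urs srs rsE]] := node_poly_roots r0 sr rho_r.
rewrite ss in srs; exists (fun k => nth 0 rs k); split.
  by move=> j k /eqP; rewrite nth_uniq ?srs// => /eqP/val_inj.
move=> w; rewrite root_notch rsE; split => [/(nthP 0)[j]|[k ->]].
  by rewrite srs => jN <-; exists (Ordinal jN).
by rewrite mem_nth ?srs.
Qed.

(** Covers both quadrature formulas. [N] is kept apart from [m * n] so that the case [m = 1] applies
    to nodes indexed by ['I_n.+1]. *)
Lemma arc_int_notches N (g : C -> C) (T : {poly C}) (zeta : 'I_N.+1 -> C) :
  N = (m * n)%N -> (size T <= (2 * N).+1)%N ->
  (forall w, `|w| = r%:C ->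
    g w = T.[w] / ((zero_poly s).[w] * (reflected_poly r s).[w])) ->
  notches r z nk m phi zeta ->
  arc_int r g = (2 * pi * r)%:C *
    \sum_k g (zeta k) / (m%:R * muB r z nk (zeta k) + 1).
Proof.
move=> NE sT gT [zinj zE].
have zroot k : root (node_poly r s rho) (zeta k).
  by apply/root_notch/zE; exists k.
have -> : arc_int r g = r%:C * cint (fun t => g (r%:C * expi t)) by [].
rewrite (@eq_cint _ _ (fun t => T.[r%:C * expi t] /
    ((zero_poly s).[r%:C * expi t] * (reflected_poly r s).[r%:C * expi t]))); last first.
  by move=> t; rewrite gT ?normr_circle.
rewrite (blaschke_quadrature r0 sr (etrans ss (esym NE)) rho_r zinj zroot sT) mulrA.
have -> : (2 * pi * r)%:C = r%:C * (2 * pi)%:C by rewrite mulrC rmorphM.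
congr (_ * _); apply: eq_bigr => k _.
by rewrite poisson_sum_repeat gT// (root_node_poly_circle r0 sr rho_r).
Qed.

End Notches.

Theorem theorem2p1 (R : realType) (r : R) (n : nat)
    (F : {fraction {poly R[i]}})
    (nu : nat) (z : 'I_nu -> R[i]) (nk : 'I_nu -> nat) (phi : R) :
  0 < r ->
  rf_degree F = n ->
  (forall a : R[i], `|a| = r%:C -> pole_order F a = 0%N) ->
  injective z ->
  (forall a : R[i],
    (`|a| < r%:C /\ (0 < pole_order (calR r F) a)%N) <-> exists k, a = z k) ->
  (forall k, nk k = pole_order (calR r F) (z k)) ->
  (\sum_(k < nu) nk k)%N = n ->
  (forall m : nat, (0 < m)%N ->
    exists zeta : 'I_(m * n).+1 -> R[i], notches r z nk m phi zeta) /\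
  (forall zeta : 'I_n.+1 -> R[i], notches r z nk 1 phi zeta ->
    arc_int r (rf_eval F) =
    (2 * pi * r)%:C *
      \sum_(k < n.+1) rf_eval F (zeta k) / (muB r z nk (zeta k) + 1)) /\
  (forall m : nat, (0 < m)%N ->
    forall zeta : 'I_(m * n).+1 -> R[i], notches r z nk m phi zeta ->
    arc_int r (fun w => `|rf_eval F w| ^+ (2 * m)) =
    (2 * pi * r)%:C *
      \sum_(k < (m * n).+1)
        `|rf_eval F (zeta k)| ^+ (2 * m) / (m%:R * muB r z nk (zeta k) + 1)).
Proof.
move=> r0 F_deg F_circle z_inj z_poles nkE sum_nk.
have z_disc k : `|z k| < r%:C by have [] := (z_poles (z k)).2 (ex_intro _ k erefl).
split => [m _|]; first exact: exists_notches.
split => [zeta|m m0 zeta].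
  have [T sT FT] := rf_eval_circle r0 F_deg F_circle z_inj z_disc nkE sum_nk.
  move=> zeta_notches.
  rewrite (arc_int_notches r0 z_disc sum_nk (esym (mul1n n)) sT _ zeta_notches).
    by congr (_ * _); apply: eq_bigr => k _; rewrite mul1r.
  by rewrite zero_poly_repeat reflected_poly_repeat.
have [T sT FT] := norm_rf_eval_circle r0 F_deg F_circle z_inj z_disc nkE sum_nk.
(* The [m]-th power of the representation of [|F| ^ 2] has numerator [T ^+ m], of degree at most
   [2 m n], and the denominator built from the zeros with multiplicities [m * nk k]. *)
apply: (arc_int_notches r0 z_disc sum_nk erefl (_ : (size (T ^+ m) <= _)%N)).
  apply: (leq_trans (size_poly_exp_leq _ _)); rewrite ltnS mulnCA mulnC leq_mul2l.
  by rewrite -subn1 leq_subLR add1n sT orbT.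
move=> w wr; rewrite exprM FT// zero_poly_repeat reflected_poly_repeat !horner_exp.
by rewrite -exprMn -expr_div_n.
Qed.
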